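(* Let $\theta\in(0,\frac{\pi}{2})$. Let $\psi$ be an eigenvector of $\Delta^{\mathsf{Mix}}_{\widetilde\Omega_\theta}$ associated with an eigenvalue $\lambda<1$. Then for all $\varepsilon>0$ the following integral is finite: $$\int_0^\infty\int_0^\pi e^{2\tilde x(\sqrt{1-\lambda}-\varepsilon)}\Big(|\psi(\tilde x,\tilde y)|^2+|\nabla\psi(\tilde x,\tilde y)|^2\Big)\,d\tilde y\,d\tilde x<\infty.$$
   Context: For $\theta\in(0,\frac{\pi}{2})$, $$\widetilde\Omega_\theta=\Big\{(\tilde x,\tilde y)\in\Big(-\frac{\pi}{\tan\theta},+\infty\Big)\times(0,\pi):\ \tilde y<\tilde x\tan\theta+\pi\ \text{ if }\ \tilde x\in\Big(-\frac{\pi}{\tan\theta},0\Big)\Big\}.$$ The Dirichlet part $\partial_{\mathsf{Dir}}\widetilde\Omega_\theta$ of its boundary is the union of the horizontal parts (contained in $\tilde y=0$ and in $\tilde y=\pi$). $\Delta^{\mathsf{Mix}}_{\widetilde\Omega_\theta}$ denotes the positive Laplacian $-\Delta$ on $L^2(\widetilde\Omega_\theta)$ with Dirichlet condition on $\partial_{\mathsf{Dir}}\widetilde\Omega_\theta$ and Neumann condition on the remaining (oblique) part of the boundary, i.e. the self-adjoint operator associated with the form $(\psi,\psi')\mapsto\int_{\widetilde\Omega_\theta}\nabla\psi\cdot\nabla\psi'$ on $\{\psi\in H^1(\widetilde\Omega_\theta):\ \psi=0\text{ on }\partial_{\mathsf{Dir}}\widetilde\Omega_\theta\}$. *)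

(* Defs.v *)
From HB Require Import structures.
From mathcomp Require Import all_boot all_order all_algebra.
From mathcomp Require Import all_classical all_reals all_analysis.
From mathcomp Require Import complex.

Set Implicit Arguments.
Unset Strict Implicit.
Unset Printing Implicit Defensive.

Import Order.TTheory GRing.Theory Num.Theory.
Import numFieldNormedType.Exports.

Local Open Scope classical_set_scope.
Local Open Scope ring_scope.
Local Open Scope complex_scope.

Section plane.
Variable R : realType.

Local Notation lebesgue2 := (@lebesgue_measure R \x @lebesgue_measure R)%E.

Implicit Types (D : set (R * R)) (u v : R * R -> R[i]).

Definition ex : R * R := (1, 0).
Definition ey : R * R := (0, 1).

Fixpoint Ck (n : nat) (f : R * R -> R) : Prop :=
  continuous f /\
  if n is m.+1 then
    [/\ forall p, derivable f p ex, forall p, derivable f p ey,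
        Ck m (fun p => 'D_ex f p) & Ck m (fun p => 'D_ey f p)]
  else True.

Definition smooth (f : R * R -> R) : Prop := forall n, Ck n f.

(* C_c^oo(D), for D open *)
Definition test_fun D (f : R * R -> R) : Prop :=
  [/\ smooth f, compact (closure [set p | f p != 0])
    & closure [set p | f p != 0] `<=` D].

Definition sqnormc (z : R[i]) : R := Normc.normc z ^+ 2.

Definition integralC D u : R[i] :=
  (\int[lebesgue2]_(p in D) complex.Re (u p)) +i*
  (\int[lebesgue2]_(p in D) complex.Im (u p)).

(* square-integrable functions; as everywhere below, functions rather than
   classes modulo a.e. equality *)
Definition L2 D u : Prop :=
  [/\ measurable_fun D (fun p => complex.Re (u p)),
      measurable_fun D (fun p => complex.Im (u p))
    & (\int[lebesgue2]_(p in D) (sqnormc (u p))%:E < +oo)%E].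

Definition dotL2 D u v : R[i] := integralC D (fun p => u p * conjc (v p)).

(* [g] is the derivative of [u] along [e] in the sense of distributions *)
Definition weak_derivative D (e : R * R) u (g : R * R -> R[i]) : Prop :=
  forall phi : R * R -> R, test_fun D phi ->
    integralC D (fun p => u p * ('D_e phi p)%:C) =
    - integralC D (fun p => g p * (phi p)%:C).

(* [u] belongs to H^1(D) and has weak gradient [(gx, gy)] *)
Definition H1 D u (gx gy : R * R -> R[i]) : Prop :=
  [/\ L2 D u, L2 D gx, L2 D gy, weak_derivative D ex u gx
    & weak_derivative D ey u gy].

Definition H1_sqnorm D u (gx gy : R * R -> R[i]) : \bar R :=
  \int[lebesgue2]_(p in D)
    (sqnormc (u p) + sqnormc (gx p) + sqnormc (gy p))%:E.

(* derivatives of smooth complex functions *)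
Definition partialC (e : R * R) u (p : R * R) : R[i] :=
  ('D_e (fun q => complex.Re (u q)) p) +i* ('D_e (fun q => complex.Im (u q)) p).

(* restrictions of these functions are dense in H^1 of a Lipschitz domain *)
Definition Cc_infty u : Prop :=
  [/\ smooth (fun p => complex.Re (u p)), smooth (fun p => complex.Im (u p))
    & compact (closure [set p | u p != 0])].

Variable theta : R.

Definition Omega : set (R * R) :=
  [set p | [/\ - (pi / tan theta) < p.1, 0 < p.2, p.2 < pi
             & (p.1 < 0 -> p.2 < p.1 * tan theta + pi)]].

(* squared L^2 norm, for arc length, on the Dirichlet boundary: the half-lines
   ]-pi/tan theta, +oo[ x {0} and ]0, +oo[ x {pi} *)
Definition dir_sqnorm u : \bar R :=
  (\int[@lebesgue_measure R]_(x in `](- (pi / tan theta))%R, +oo[)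
     (sqnormc (u (x, 0%R)))%:E
   + \int[@lebesgue_measure R]_(x in `]0%R, +oo[) (sqnormc (u (x, pi)))%:E)%E.

(* The trace on the Dirichlet boundary is the extension by continuity, from
   H^1 to L^2, of the restriction map on [Cc_infty].  [gx], [gy] is the weak
   gradient of [u], and only the values of [t] on the Dirichlet boundary
   matter. *)
Definition dir_trace u (gx gy t : R * R -> R[i]) : Prop :=
  exists w : nat -> R * R -> R[i],
    [/\ forall n, Cc_infty (w n),
        H1_sqnorm Omega (fun p => w n p - u p)
          (fun p => partialC ex (w n) p - gx p)
          (fun p => partialC ey (w n) p - gy p) @[n --> \oo] --> 0%E
      & dir_sqnorm (fun p => w n p - t p) @[n --> \oo] --> 0%E].

(* form domain, with the weak gradient of [u] recorded *)
Definition mix_form_domain u (gx gy : R * R -> R[i]) : Prop :=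
  H1 Omega u gx gy /\ dir_trace u gx gy (fun=> 0).

(* graph of the self-adjoint operator associated with the form:
   [u] is in its domain and is mapped to [f] *)
Definition mix_laplacian u (f : R * R -> R[i]) : Prop :=
  L2 Omega f /\
  exists gx gy, mix_form_domain u gx gy /\
    forall v hx hy, mix_form_domain v hx hy ->
      dotL2 Omega gx hx + dotL2 Omega gy hy = dotL2 Omega f v.

Definition mix_eigenvector (lambda : R) u : Prop :=
  ~ {ae lebesgue2, forall p, Omega p -> u p = 0} /\
  mix_laplacian u (fun p => lambda%:C * u p).

End plane.

(* Main.v *)
Require Import Defs.
From HB Require Import structures.
From mathcomp Require Import all_boot all_order all_algebra.
From mathcomp Require Import all_classical all_reals all_analysis.
From mathcomp Require Import complex.
From mathcomp Require Import measurable_realfun ring lra.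

Set Implicit Arguments.
Unset Strict Implicit.
Unset Printing Implicit Defensive.

Import Order.TTheory GRing.Theory Num.Theory.
Import numFieldNormedType.Exports.

Local Open Scope classical_set_scope.
Local Open Scope ring_scope.

(** The decay is an Agmon estimate. Let [w] be a smooth function of the abscissa, bounded along
    with its derivative. Multiplication by [w ^+ 2] preserves the form domain
    ([mix_form_domainM]), so the eigenvalue equation can be tested against [w ^+ 2 * psi]; the
    real part of the result is
    [\int |grad (w * psi)|^2 = \int (lambda * w ^+ 2 + (w') ^+ 2) * |psi|^2].
    On vertical segments of the half-strip [x > 0], of length pi, [psi] vanishes at both ends, so
    the Poincare inequality with constant 1 gives
    [\int w ^+ 2 * |psi|^2 <= \int w ^+ 2 * |'D_y psi|^2] there. If moreover [0 <= w' <= b * w]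
    with [lambda + b ^+ 2 < 1], and [w <= 1] for [x <= 0], the right-hand side of the identity is
    absorbed up to a multiple of the norm of [psi], and the integral of
    [w ^+ 2 * (|psi|^2 + |grad psi|^2)] over the half-strip is bounded by a constant that does not
    involve [w] ([agmon_bound]). The functions [1 / (expR (- b * x) + d)] satisfy all these
    requirements and increase to [expR (b * x)] as [d] tends to 0, so monotone convergence
    replaces [w] by the exponential ([weighted_integral_le]).

    The Dirichlet condition is only known through a sequence of smooth functions that converges
    in H^1 and whose boundary values tend to 0. For these the Poincare inequality is proved with
    boundary terms and with any constant [k ^+ 2 < 1] ([poincare_itv], [strip_poincare]), which
    the strict inequality [lambda + b ^+ 2 < 1] allows, and then passed to the limit
    ([form_strip_poincare]).

    Finally the gradient in the estimate is an arbitrary weak gradient of [psi], while the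
    argument concerns the one given by the domain of the operator. They agree almost everywhere
    on the half-strip by the du Bois-Reymond lemma ([weak_derivativeR_unique]), whose test
    functions are built from [expR (- 1 / x)]. *)

(** * Smooth functions of two variables, weights, and the one-dimensional Poincare inequality *)

Section calculus.
Variable R : realType.
Implicit Types (f g : R * R -> R) (p e : R * R) (n : nat).

(** The induction step in every proof that a function given by a formula is smooth: it is
    enough to know the two partial derivatives as functions, and not as derivatives. *)
Lemma Ck_is_derive n f fx fy :
  (forall p, is_derive p (ex R) f (fx p)) ->
  (forall p, is_derive p (ey R) f (fy p)) -> continuous f ->
  Ck n fx -> Ck n fy -> Ck n.+1 f.
Proof.
move=> dx dy cf Cx Cy; split=> //; split.
- by move=> p; apply: ex_derive.
- by move=> p; apply: ex_derive.
- by rewrite (_ : (fun p => _) = fx)//; apply/funext => p; rewrite derive_val.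
- by rewrite (_ : (fun p => _) = fy)//; apply/funext => p; rewrite derive_val.
Qed.

Lemma Ck_le n f : Ck n.+1 f -> Ck n f.
Proof.
elim: n f => [|n ih] f; first by case.
by move=> [cf [? ? /ih ? /ih ?]]; split.
Qed.

Lemma Ck_cst n (c : R) : Ck n (fun=> c).
Proof.
elim: n c => [|n ih] c; first by split=> // p; exact: cvg_cst.
by apply: (@Ck_is_derive _ _ (fun=> 0) (fun=> 0)) => // p; exact: cvg_cst.
Qed.

Lemma CkD n f g : Ck n f -> Ck n g -> Ck n (fun p => f p + g p).
Proof.
elim: n f g => [|n ih] f g.
  by move=> [cf _] [cg _]; split=> // p; apply: cvgD; [exact: cf|exact: cg].
move=> [cf [fx fy Cfx Cfy]] [cg [gx gy Cgx Cgy]].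
apply: (Ck_is_derive (fx := fun p => 'D_(ex R) f p + 'D_(ex R) g p)
  (fy := fun p => 'D_(ey R) f p + 'D_(ey R) g p)); [| | |exact: ih|exact: ih] => p.
- by apply: is_deriveD; apply: derivableP.
- by apply: is_deriveD; apply: derivableP.
- by apply: cvgD; [exact: cf|exact: cg].
Qed.

Lemma CkM n f g : Ck n f -> Ck n g -> Ck n (fun p => f p * g p).
Proof.
elim: n f g => [|n ih] f g.
  by move=> [cf _] [cg _]; split=> // p; apply: cvgM; [exact: cf|exact: cg].
move=> Cf Cg; have Cf' := Ck_le Cf; have Cg' := Ck_le Cg.
move: Cf Cg => [cf [fx fy Cfx Cfy]] [cg [gx gy Cgx Cgy]].
apply: (Ck_is_derive (fx := fun p => f p * 'D_(ex R) g p + g p * 'D_(ex R) f p)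
  (fy := fun p => f p * 'D_(ey R) g p + g p * 'D_(ey R) f p)).
- by move=> p; apply: is_deriveM; apply: derivableP.
- by move=> p; apply: is_deriveM; apply: derivableP.
- by move=> p; apply: cvgM; [exact: cf|exact: cg].
- by apply: CkD; exact: ih.
- by apply: CkD; exact: ih.
Qed.

(** A directional derivative is the derivative at 0 of a function of one real variable,
    so the chain rule of one-variable calculus applies to it. *)
Lemma is_derive_line f p e d :
  is_derive (0 : R) 1 (fun h => f (h *: e + p)) d <-> is_derive p e f d.
Proof.
have E : (fun h : R => h^-1 *: (((fun h => f (h *: e + p)) \o shift 0) (h *: 1) -
    (fun h => f (h *: e + p)) 0)) = (fun h => h^-1 *: ((f \o shift p) (h *: e) - f p)).
  apply/funext => h /=; rewrite addr0 scale0r add0r.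
  by rewrite /GRing.scale/= mulr1.
split=> -[]; rewrite /derivable /derive.
  by rewrite E => ? ?; split.
by rewrite -E => ? ?; split.
Qed.

Lemma is_derive_affine (h : R -> R) (a b c d : R) p e :
  is_derive (a * p.1 + b * p.2 + c) 1 h d ->
  is_derive p e (fun q => h (a * q.1 + b * q.2 + c)) ((a * e.1 + b * e.2) * d).
Proof.
move=> hd; apply/is_derive_line.
rewrite (_ : (fun t => _) = h \o (fun t : R => t * (a * e.1 + b * e.2) +
  (a * p.1 + b * p.2 + c))); last first.
  apply/funext => t /=; congr (h _); rewrite /GRing.scale/=; ring.
have hd' : is_derive (0 * (a * e.1 + b * e.2) + (a * p.1 + b * p.2 + c)) 1 h d.
  by rewrite mul0r add0r.
rewrite [_ * d]mulrC; apply: is_derive1_comp.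
have := is_deriveD (is_deriveM (is_derive_id (0 : R) (1 : R))
  (is_derive_cst (a * e.1 + b * e.2) (0 : R) (1 : R)))
  (is_derive_cst (a * p.1 + b * p.2 + c) (0 : R) (1 : R)).
by rewrite scale0r add0r addr0 /GRing.scale/= mulr1.
Qed.

(** The derivative of [flat m] is a combination of [flat m.+2] and [flat m.+1]: the family
    is stable under differentiation, and this makes its members smooth although they vanish on
    a half-line. All compactly supported test functions below are built from [flat 0]. *)
Definition flat (m : nat) (x : R) : R := if 0 < x then x ^- m * expR (- x^-1) else 0.

Lemma flat_ge0 m x : 0 <= flat m x.
Proof.
rewrite /flat; case: ifPn => // x0.
by rewrite mulr_ge0 ?expR_ge0// invr_ge0 exprn_ge0// ltW.
Qed.

(** The exponential series gives [expR t >= t ^+ m.+2 / m.+2`!], used at [t = 1 / x]. The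
    quadratic bound is what makes [flat m] differentiable at 0, with derivative 0. *)
Lemma flat_le m x : flat m x <= m.+2`!%:R * x ^+ 2.
Proof.
rewrite /flat; case: ifPn => x0; last by rewrite mulr_ge0// sqr_ge0.
have x0' : 0 <= x^-1 by rewrite invr_ge0 ltW.
have := expR_ge1Dxn m.+1 x0' => h.
have {h} : x^-1 ^+ m.+2 / m.+2`!%:R <= expR x^-1.
  by apply: le_trans h; rewrite lerDr.
have f0 : 0 < m.+2`!%:R :> R by rewrite ltr0n fact_gt0.
rewrite ler_pdivrMr// => h.
rewrite expRN ler_pdivrMr ?expR_gt0//.
rewrite exprVn -addn2 exprD invfM in h.
rewrite -addn2 mulrAC -ler_pdivrMr ?exprn_gt0// mulrC.
by rewrite (mulrC (_ `!%:R)) mulrC.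
Qed.
Lemma is_derive_flat0 m : is_derive (0 : R) 1 (flat m) 0.
Proof.
suff h : (fun h => h^-1 *: ((flat m \o shift 0) (h *: (1 : R)) - flat m 0)) @ 0^' --> (0 : R).
  by split; [apply/cvg_ex; exists 0|apply/cvg_lim].
apply/cvgr0Pnorm_le => e e0.
have M0 : 0 < m.+2`!%:R :> R by rewrite ltr0n fact_gt0.
near=> h.
have h0 : h != 0 by near: h; exact: nbhs_dnbhs_neq.
rewrite /= addr0 /GRing.scale/= mulr1 {2}/flat ltxx subr0 normrM.
rewrite (ger0_norm (flat_ge0 _ _)) normrV ?unitfE//.
rewrite mulrC ler_pdivrMr ?normr_gt0//.
apply: (le_trans (flat_le m h)); rewrite -real_normK ?num_real// expr2 mulrA.
rewrite ler_wpM2r// -ler_pdivlMl//.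
near: h; apply: dnbhs0_le; rewrite mulr_gt0// invr_gt0.
Unshelve. all: by end_near. Qed.

(** Away from 0 this is calculus, as the function agrees near the point with
    a formula; at 0 it rests on [flat_le]. *)
Lemma is_derive_flat m (x : R) :
  is_derive (x : R) 1 (flat m) (flat m.+2 x - m%:R * flat m.+1 x).
Proof.
have [x0|x0|->] := ltrgtP x 0.
- rewrite /flat ltNge (ltW x0)/= mulr0 subr0.
  apply: (@near_eq_is_derive _ _ _ (cst 0)).
  near=> y; rewrite ltNge /= (_ : y <= 0)//; apply: ltW; near: y.
  exact: lt_nbhsl.
- have xn : x != 0 by rewrite gt_eqF.
  pose g : R -> R := fun y : R => (y ^+ m)^-1 * expR (- y^-1).
  have E : \near x, g x = flat m x.
    near=> y; rewrite /flat (_ : 0 < y)//; near: y; exact: lt_nbhsr.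
  have d0 : is_derive x 1 (fun y : R => y ^+ m) (m%:R * x ^+ m.-1).
    by split; [exact: exprn_derivable|rewrite exp_derive /GRing.scale/= mulr1].
  have d1 := is_deriveV (f := fun y : R => y ^+ m) (expf_neq0 m xn) d0.
  have d2 := is_deriveN (is_deriveV (f := id) xn (is_derive_id x (1 : R))).
  have d3 := is_derive1_comp (g := fun y : R => - y^-1) (is_derive_expR (- x^-1)) d2.
  apply: (near_eq_is_derive E).
  refine (is_derive_eq (is_deriveM d1 d3) _).
  rewrite /flat x0 /GRing.scale/= !mulr1.
  case: m {g E d0 d1} => [|m].
    by field.
  by rewrite succnK !exprS; field; rewrite xn expf_neq0.
- have flat0 k : flat k 0 = 0 by rewrite /flat ltxx.
  by rewrite !flat0 mulr0 subr0; exact: is_derive_flat0.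
Unshelve. all: by end_near. Qed.

Lemma flat_continuous m : continuous (flat m).
Proof.
move=> x; apply/differentiable_continuous/derivable1_diffP.
by have := is_derive_flat m x => -[].
Qed.

Lemma Ck_flat n m (a b c : R) : Ck n (fun p => flat m (a * p.1 + b * p.2 + c)).
Proof.
have cont k : continuous (fun p : R * R => flat k (a * p.1 + b * p.2 + c)).
  move=> p; apply: (@continuous_comp _ _ _ (fun p : R * R => a * p.1 + b * p.2 + c) (flat k)).
    by apply: cvgD; [apply: cvgD; apply: cvgMr; [exact: cvg_fst|exact: cvg_snd]|exact: cvg_cst].
  exact: flat_continuous.
elim: n m => [|n ih] m; first by split.
pose g := fun p : R * R => flat m.+2 (a * p.1 + b * p.2 + c) +
  (- m%:R) * flat m.+1 (a * p.1 + b * p.2 + c).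
have Cg : Ck n g by apply: CkD => //; apply: CkM => //; exact: Ck_cst.
apply: (@Ck_is_derive _ _ (fun p => (a * (ex R).1 + b * (ex R).2) * g p)
  (fun p => (a * (ey R).1 + b * (ey R).2) * g p)) => //.
- by move=> p; apply: is_derive_affine; rewrite /g mulNr; exact: is_derive_flat.
- by move=> p; apply: is_derive_affine; rewrite /g mulNr; exact: is_derive_flat.
- by apply: CkM => //; exact: Ck_cst.
- by apply: CkM => //; exact: Ck_cst.
Qed.

(** A smooth bounded substitute for the exponential growth [expR (b * x)], which it approaches
    from below as [d] decreases to 0. Boundedness makes the product with a function of the form
    domain stay in the form domain; nothing in the final estimate depends on [d]. *)
Definition weight (b d x : R) : R := (expR (- (b * x)) + d)^-1.

Lemma weight_den_gt0 (b d x : R) : 0 < d -> 0 < expR (- (b * x)) + d.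
Proof. by move=> d0; rewrite addr_gt0// expR_gt0. Qed.

Lemma weight_gt0 (b d x : R) : 0 < d -> 0 < weight b d x.
Proof. by move=> d0; rewrite invr_gt0 weight_den_gt0. Qed.

(** The factor [1 - d * w] of the logarithmic derivative of the weight [w] is therefore
    between 0 and 1: this is the inequality [0 <= w' <= b * w] of the energy estimate. *)
Lemma weight_le (b d x : R) : 0 < d -> d * weight b d x <= 1.
Proof.
move=> d0; rewrite ler_pdivrMr ?weight_den_gt0// mul1r.
by rewrite lerDr expR_ge0.
Qed.

Lemma weight_le1 (b d x : R) : 0 < d -> 0 <= b -> x <= 0 -> weight b d x <= 1.
Proof.
move=> d0 b0 x0; rewrite invf_le1 ?weight_den_gt0//.
have : 1 <= expR (- (b * x)) by rewrite -expR0 ler_expR oppr_ge0 mulr_ge0_le0.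
by move=> h; rewrite (le_trans h)// lerDl ltW.
Qed.

(** The weight solves the logistic equation. Its derivative being a polynomial in the
    weight itself, smoothness follows by induction. *)
Lemma is_derive_weight (b d x : R) : 0 < d ->
  is_derive x 1 (weight b d) (b * weight b d x * (1 - d * weight b d x)).
Proof.
move=> d0; have n0 : expR (- (b * x)) + d != 0 by rewrite gt_eqF ?weight_den_gt0.
have d1 : is_derive x 1 (fun y : R => - (b * y)) (- b).
  have := is_deriveN (is_deriveM (is_derive_cst b x (1 : R)) (is_derive_id x (1 : R))).
  by rewrite scaler0 addr0 /GRing.scale/= mulr1.
have d2 := is_derive1_comp (g := fun y : R => - (b * y)) (is_derive_expR (- (b * x))) d1.
have d3 := is_deriveD d2 (is_derive_cst d x (1 : R)).
refine (is_derive_eq (is_deriveV (f := fun y : R => expR (- (b * y)) + d) n0 d3) _).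
by rewrite /weight /GRing.scale/= addr0; field.
Qed.

Lemma weight_continuous (b d : R) : 0 < d -> continuous (weight b d).
Proof.
move=> d0 x; apply/differentiable_continuous/derivable1_diffP.
by have := is_derive_weight b x d0 => -[].
Qed.

Lemma is_derive_weight_fst (b d : R) p e : 0 < d ->
  is_derive p e (fun q => weight b d q.1)
    (e.1 * (b * weight b d p.1 * (1 - d * weight b d p.1))).
Proof.
move=> d0; have := @is_derive_affine (weight b d) 1 0 0 _ p e.
rewrite !mul1r !mul0r !addr0 => /(_ _ (is_derive_weight _ _ d0)).
by under eq_fun do rewrite mul1r mul0r !addr0.
Qed.

Lemma Ck_weight n (b d : R) : 0 < d -> Ck n (fun p => weight b d p.1).
Proof.
move=> d0; have cont : continuous (fun p : R * R => weight b d p.1).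
  by move=> p; apply: continuous_comp; [exact: cvg_fst|exact: weight_continuous].
elim: n => [|n ih]; first by split.
pose g := fun p : R * R => b * weight b d p.1 * (1 + (- d) * weight b d p.1).
have Cg : Ck n g.
  apply: CkM; first by apply: CkM => //; exact: Ck_cst.
  by apply: CkD; [exact: Ck_cst|apply: CkM => //; exact: Ck_cst].
have E p e : is_derive p e (fun q => weight b d q.1) (e.1 * g p).
  by rewrite /g mulNr; exact: is_derive_weight_fst.
apply: (@Ck_is_derive _ _ (fun p => (ex R).1 * g p) (fun p => (ey R).1 * g p)) => //.
- by apply: CkM => //; exact: Ck_cst.
- by apply: CkM => //; exact: Ck_cst.
Qed.

Lemma weight_cvg (b x : R) (d : nat -> R) : d n @[n --> \oo] --> (0 : R) ->
  weight b (d n) x @[n --> \oo] --> expR (b * x).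
Proof.
move=> d0; rewrite -[expR _]invrK -expRN; apply: cvgV.
  by rewrite gt_eqF ?expR_gt0.
by rewrite -[X in _ --> X]addr0; apply: cvgD => //; exact: cvg_cst.
Qed.

(** The sharp Poincare inequality on [[0, pi]] with a slightly smaller constant, and with
    boundary values instead of a Dirichlet condition, so that it applies to the smooth functions
    that only approximate a function with zero trace. The auxiliary function
    [phi y = k * tan (k * (y - pi / 2))] solves [phi' = k ^+ 2 + phi ^+ 2] and is smooth on the closed
    interval because [k < 1], so that
    [0 <= (f' + phi * f) ^+ 2 = f' ^+ 2 - k ^+ 2 * f ^+ 2 + (phi * f ^+ 2)'], and it remains to
    integrate the last term. *)
Lemma poincare_itv (k : R) (f f' : R -> R) : 0 < k < 1 ->
  (forall y : R, is_derive y 1 f (f' y)) -> continuous f' ->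
  (\int[@lebesgue_measure R]_(y in `[0%R, pi]) (k ^+ 2 * f y ^+ 2)%:E <=
   \int[@lebesgue_measure R]_(y in `[0%R, pi]) (f' y ^+ 2)%:E +
   (k * tan (k * (pi / 2)) * (f 0 ^+ 2 + f pi ^+ 2))%:E)%E.
Proof.
move=> /andP[k0 k1] df cf'.
have cf : continuous f.
  move=> x; apply/differentiable_continuous/derivable1_diffP.
  by have := df x => -[].
have pi0 := @pi_gt0 R.
pose l y : R := k * (y - pi / 2).
pose phi y : R := k * tan (l y).
have cos0 y : 0 <= y <= pi -> 0 < cos (l y).
  move=> /andP[y0 yp]; apply: cos_gt0_pihalf; rewrite /l; apply/andP; split; nra.
have dl (y : R) : is_derive y 1 l k.
  have := is_deriveM (is_derive_cst k y (1 : R))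
    (is_deriveB (is_derive_id y (1 : R)) (is_derive_cst (pi / 2) y (1 : R))).
  by rewrite subr0 scaler0 addr0 /GRing.scale/= mulr1.
have dphi (y : R) : 0 <= y <= pi -> is_derive y 1 phi (k ^+ 2 + phi y ^+ 2).
  move=> /cos0 c0; have := is_derive1_comp (is_derive_tan (lt0r_neq0 c0)) (dl y) => h.
  have := is_deriveM (is_derive_cst k y (1 : R)) h.
  rewrite scaler0 addr0 /GRing.scale/= => {}h; refine (is_derive_eq h _).
  rewrite cos2_tan2 ?gt_eqF// /phi.
  by ring.
pose Phi y : R := phi y * f y ^+ 2.
pose Phi' y : R := (k ^+ 2 + phi y ^+ 2) * f y ^+ 2 + 2 * phi y * f y * f' y.
have dPhi (y : R) : 0 <= y <= pi -> is_derive y 1 Phi (Phi' y).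
  move=> h; have := is_deriveM (dphi _ h) (is_deriveM (df y) (df y)).
  move=> h'; refine (is_derive_eq h' _); rewrite mulrfctE /Phi' /GRing.scale/=; ring.
have cphi (y : R) : 0 <= y <= pi -> {for y, continuous phi}.
  move=> h; apply/differentiable_continuous/derivable1_diffP.
  by have := dphi y h => -[].
have cPhi (y : R) : 0 <= y <= pi -> {for y, continuous Phi}.
  by move=> h; rewrite /Phi; apply: cvgM; [exact: cphi|apply: cvgM; exact: cf].
have cPhi' (y : R) : 0 <= y <= pi -> {for y, continuous Phi'}.
  move=> h; rewrite /Phi'; have cphi2 : {for y, continuous (fun y => phi y ^+ 2)}.
    by apply: cvgM; exact: cphi.
  have cf2 : {for y, continuous (fun y => f y ^+ 2)} by apply: cvgM; exact: cf.
  apply: cvgD; first by apply: cvgM => //; apply: cvgD => //; exact: cvg_cst.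
  apply: cvgM; last exact: cf'.
  apply: cvgM; last exact: cf.
  by apply: cvgM; [exact: cvg_cst|exact: cphi].
have wPhi' : {within `[0, pi], continuous Phi'}.
  apply: continuous_in_subspaceT => y; rewrite inE/= in_itv/=; exact: cPhi'.
have iPhi' : (@lebesgue_measure R).-integrable `[0, pi] (EFin \o Phi').
  by apply: continuous_compact_integrable => //; exact: segment_compact.
have if' : (@lebesgue_measure R).-integrable `[0, pi] (fun y => (f' y ^+ 2)%:E).
  apply: (@continuous_compact_integrable _ (fun y => f' y ^+ 2)); first exact: segment_compact.
  by apply: continuous_subspaceT => y; apply: cvgM; exact: cf'.
have if2 : (@lebesgue_measure R).-integrable `[0, pi] (fun y => (k ^+ 2 * f y ^+ 2)%:E).
  apply: (@continuous_compact_integrable _ (fun y => k ^+ 2 * f y ^+ 2)); first exact: segment_compact.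
  by apply: continuous_subspaceT => y; apply: cvgM; [exact: cvg_cst|apply: cvgM; exact: cf].
(* The boundary values of [phi] at 0 and [pi] are opposite, so that both give the same sign. *)
have ftc : (\int[@lebesgue_measure R]_(y in `[0%R, pi]) (Phi' y)%:E =
    (k * tan (k * (pi / 2)) * (f 0 ^+ 2 + f pi ^+ 2))%:E)%E.
  rewrite (continuous_FTC2 (F := Phi) pi0 wPhi').
  - rewrite -EFinB; congr EFin.
    rewrite /Phi /phi /l sub0r (_ : pi - pi / 2 = pi / 2 :> R); last by field.
    by rewrite mulrN tanN; ring.
  - split.
    + move=> y; rewrite in_itv/= => /andP[y0 y1].
      have hy : 0 <= y <= pi by rewrite !ltW.
      by case: (dPhi y hy).
    + by apply: cvg_at_right_filter; apply: cPhi; rewrite lexx ltW.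
    + by apply: cvg_at_left_filter; apply: cPhi; rewrite lexx ltW.
  - move=> y; rewrite in_itv/= => /andP[y0 y1].
    have hy : 0 <= y <= pi by rewrite !ltW.
    by case: (dPhi y hy) => _ <-; rewrite derive1E.
rewrite -ftc -integralD//; apply: le_integral => //.
  exact: integrableD.
move=> y _; rewrite lee_fin /Phi' -subr_ge0.
rewrite (_ : _ - _ = (f' y + phi y * f y) ^+ 2) ?sqr_ge0//; ring.
Qed.
End calculus.

(** * Borel measurability in the plane *)

Section measurability.
Variable R : realType.
Local Notation T2 := (measurableTypeR R * measurableTypeR R)%type.

(** The boxes around rational points with radius the inverse of an integer form a countable
    basis of the plane. *)
Lemma open_measurable2 (U : set (R * R)) : open U -> measurable (U : set T2).
Proof.
move=> oU.
pose B (q : rat * rat * nat) : set (R * R) :=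
  ball (ratr q.1.1 : R) (q.2.+1%:R^-1 : R) `*` ball (ratr q.1.2 : R) (q.2.+1%:R^-1 : R).
have -> : U = \bigcup_(q in [set q | B q `<=` U]) B q.
  apply/seteqP; split=> [p Up|p [q qU] /qU//].
  have /nbhs_ballP[r /= r0 rU] : nbhs p U by exact: open_nbhs_nbhs.
  have [n nr] : exists n : nat, n.+1%:R^-1 + n.+1%:R^-1 < r.
    have r20 : 0 < r / 2 by lra.
    by have [n] := ltr_add_invr r20; move=> H; exists n; move: (n.+1%:R^-1) H => m; lra.
  set d : R := n.+1%:R^-1 in nr *.
  have d0 : 0 < d by rewrite invr_gt0 ltr0n.
  have approx (x : R) : exists q : rat, `|ratr q - x| < d.
    have [q] := @rat_in_itvoo _ (x - d) (x + d) ltac:(lra).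
    rewrite in_itv/= => /andP[h1 h2]; exists q; rewrite ltr_norml; lra.
  have [a ha] := approx p.1; have [b hb] := approx p.2.
  exists (a, b, n); last by split.
  move=> x [/= hx1 hx2]; apply: rU; split; rewrite /ball/= distrC.
    rewrite -(subrK (ratr a) x.1) -addrA; apply: le_lt_trans (ler_normD _ _) _.
    by move: hx1; rewrite /ball/= distrC -/d => ?; lra.
  rewrite -(subrK (ratr b) x.2) -addrA; apply: le_lt_trans (ler_normD _ _) _.
  by move: hx2; rewrite /ball/= distrC -/d => ?; lra.
rewrite bigcup_mkcond; apply: countable_bigcupT_measurable => [|q].
  exact: countableP.
case: ifPn => _ //; apply: measurableX; exact: measurable_ball.
Qed.

Lemma continuous_measurable2 (f : R * R -> R) D : measurable (D : set T2) -> continuous f ->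
  measurable_fun (D : set T2) f.
Proof.
move=> mD /continuousP cf; apply: (measurability _ (RGenOpens.measurableE R)).
move=> _ [_ [a [b ->]] <-]; apply: measurableI => //.
by apply: open_measurable2; apply: cf; exact: interval_open.
Qed.

End measurability.

(** * Square-integrable functions *)

Section square_integrable.
Context d (T : measurableType d) (R : realType).
Variables (mu : {measure set T -> \bar R}) (D : set T).
Hypothesis mD : measurable D.
Implicit Types f g h : T -> R.

(** Real-valued square-integrable functions; complex-valued ones are handled through their
    real and imaginary parts, see [L2P]. *)
Definition sqint f := measurable_fun D f /\ mu.-integrable D (fun x => (f x ^+ 2)%:E).

Lemma sqintP f : measurable_fun D f ->
  (\int[mu]_(x in D) (f x ^+ 2)%:E < +oo)%E -> sqint f.
Proof.
move=> mf foo; split=> //; apply/integrableP; split.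
  by apply/measurable_EFinP; exact: measurable_funX.
apply: le_lt_trans foo; rewrite le_eqVlt; apply/orP; left; apply/eqP.
by apply: eq_integral => x _; rewrite /= ger0_norm// sqr_ge0.
Qed.

Lemma sqint_integrableM f g : sqint f -> sqint g ->
  mu.-integrable D (fun x => (f x * g x)%:E).
Proof.
move=> [mf f2] [mg g2].
apply: (le_integrable mD (g := fun x => (f x ^+ 2)%:E + (g x ^+ 2)%:E)%E).
- by apply/measurable_EFinP; exact: measurable_funM.
- move=> x _; rewrite -EFinD !abse_EFin lee_fin (ger0_norm (addr_ge0 _ _)) ?sqr_ge0//.
  by rewrite ler_norml; apply/andP; split; nra.
- exact: integrableD.
Qed.

Lemma sqintD f g : sqint f -> sqint g -> sqint (fun x => f x + g x).
Proof.
move=> sf sg; have fg := sqint_integrableM sf sg; case: sf sg => [mf f2] [mg g2].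
split; first exact: measurable_funD.
apply: (eq_integrable mD (fun x => ((f x ^+ 2)%:E + (2%:E * (f x * g x)%:E + (g x ^+ 2)%:E))%E)).
  by move=> x _; rewrite -EFinM -!EFinD; congr EFin; ring.
apply: integrableD => //; apply: integrableD => //; exact: integrableZl.
Qed.

Lemma integrable_bddM h f (M : R) : measurable_fun D h ->
  (forall x, D x -> `|h x| <= M) ->
  mu.-integrable D (fun x => (f x)%:E) ->
  mu.-integrable D (fun x => (h x * f x)%:E).
Proof.
move=> mh hM fi; have [mf _] := integrableP _ _ _ fi.
apply: (le_integrable mD (g := fun x => (M%:E * (f x)%:E)%E)).
- by apply/measurable_EFinP; apply: measurable_funM => //; exact/measurable_EFinP.
- move=> x Dx; rewrite -EFinM !abse_EFin lee_fin !normrM ler_wpM2r//.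
  by rewrite (le_trans (hM _ Dx))// ler_norm.
- exact: integrableZl.
Qed.

Lemma sqint_bddM h f (M : R) : measurable_fun D h ->
  (forall x, D x -> `|h x| <= M) -> sqint f -> sqint (fun x => h x * f x).
Proof.
move=> mh hM [mf f2]; split; first exact: measurable_funM.
apply: (eq_integrable mD (fun x => (h x ^+ 2 * f x ^+ 2)%:E)).
  by move=> x _; rewrite exprMn.
apply: (@integrable_bddM _ _ (M ^+ 2)) => //; first exact: measurable_funX.
move=> x Dx; rewrite normrX; have := hM x Dx; have := normr_ge0 (h x); nra.
Qed.

End square_integrable.

(** * Complex-valued functions on the plane *)

Section plane_functions.
Variable R : realType.
Local Notation T2 := (measurableTypeR R * measurableTypeR R)%type.
Local Notation mu2 := (@lebesgue_measure R \x @lebesgue_measure R)%E.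
Local Notation Re := complex.Re.
Local Notation Im := complex.Im.
Implicit Types (D : set (R * R)) (u v : R * R -> R[i]) (f g h : R * R -> R).

Lemma sqnormcE (z : R[i]) : sqnormc z = Re z ^+ 2 + Im z ^+ 2.
Proof. by case: z => a b; rewrite /sqnormc /= sqr_sqrtr// addr_ge0 ?sqr_ge0. Qed.

Lemma sqnormc_ge0 (z : R[i]) : 0 <= sqnormc z.
Proof. exact: sqr_ge0. Qed.

Lemma Re_mulr_real (z : R[i]) (r : R) : Re (z * r%:C%C) = Re z * r.
Proof. by case: z => a b /=; rewrite mulr0 subr0. Qed.

Lemma Im_mulr_real (z : R[i]) (r : R) : Im (z * r%:C%C) = Im z * r.
Proof. by case: z => a b /=; rewrite mulr0 add0r. Qed.

Lemma Re_mull_real (z : R[i]) (r : R) : Re (r%:C%C * z) = r * Re z.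
Proof. by case: z => a b /=; rewrite mul0r subr0. Qed.

Lemma Im_mull_real (z : R[i]) (r : R) : Im (r%:C%C * z) = r * Im z.
Proof. by case: z => a b /=; rewrite mul0r addr0. Qed.

Lemma Re_dot (z w : R[i]) : Re (z * conjc w) = Re z * Re w + Im z * Im w.
Proof. by case: z w => [a b] [c e] /=; rewrite mulrN opprK. Qed.

Lemma L2P D u : measurable (D : set T2) ->
  L2 D u <-> sqint mu2 D (fun p => Re (u p)) /\ sqint mu2 D (fun p => Im (u p)).
Proof.
move=> mD; split=> [[mr mi uoo]|[[mr r2] [mi i2]]].
  split; apply: sqintP => //; apply: le_lt_trans uoo; apply: ge0_le_integral => //.
  - by move=> p _; rewrite lee_fin sqr_ge0.
  - by apply/measurable_EFinP; exact: measurable_funX.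
  - apply/measurable_EFinP; under eq_fun do rewrite sqnormcE.
    by apply: measurable_funD; exact: measurable_funX.
  - by move=> p _; rewrite lee_fin sqnormcE lerDl sqr_ge0.
  - by move=> p _; rewrite lee_fin sqr_ge0.
  - by apply/measurable_EFinP; exact: measurable_funX.
  - apply/measurable_EFinP; under eq_fun do rewrite sqnormcE.
    by apply: measurable_funD; exact: measurable_funX.
  - by move=> p _; rewrite lee_fin sqnormcE lerDr sqr_ge0.
split=> //; have /integrableP[_] := integrableD mD r2 i2.
apply: le_lt_trans; rewrite le_eqVlt; apply/orP; left; apply/eqP.
apply: eq_integral => p _ /=; rewrite sqnormcE ger0_norm// addr_ge0 ?sqr_ge0//.
Qed.

Lemma L2_integrable D u : measurable (D : set T2) -> L2 D u ->
  mu2.-integrable D (fun p => (sqnormc (u p))%:E).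
Proof.
move=> mD /(L2P _ mD)[[_ r2] [_ i2]].
apply: (eq_integrable mD (fun p => ((Re (u p) ^+ 2)%:E + (Im (u p) ^+ 2)%:E)%E)).
  by move=> p _; rewrite sqnormcE EFinD.
exact: integrableD.
Qed.

Lemma measurable_sqnormc D u : measurable_fun (D : set T2) (fun p => Re (u p)) ->
  measurable_fun (D : set T2) (fun p => Im (u p)) ->
  measurable_fun (D : set T2) (fun p => (sqnormc (u p))%:E).
Proof.
move=> mr mi; apply/measurable_EFinP; under eq_fun do rewrite sqnormcE.
by apply: measurable_funD; exact: measurable_funX.
Qed.

Lemma compact_support_bounded (K : set (R * R)) f : compact K -> continuous f ->
  (forall p, ~ K p -> f p = 0) -> exists M, forall p, `|f p| <= M.
Proof.
move=> cK cf f0.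
have /compact_bounded[M [_ hM]] : compact (f @` K).
  by apply: continuous_compact => //; exact: continuous_subspaceT.
exists (`|M| + 1) => p; have [Kp|/f0 ->] := pselect (K p); last by rewrite normr0 addr_ge0.
by apply: hM; [rewrite (le_lt_trans (ler_norm M))// ltrDl|exists p].
Qed.

Lemma compact_finite_measure2 (K : set (R * R)) : compact K -> (mu2 K < +oo)%E.
Proof.
move=> cK; have [M [_ hM]] := compact_bounded cK.
pose I : set (measurableTypeR R) := [set` `[- (`|M| + 1), `|M| + 1]%R].
have KI : K `<=` I `*` I.
  move=> p Kp; have h : `|p| <= `|M| + 1.
    by apply: hM => //; rewrite (le_lt_trans (ler_norm M))// ltrDl.
  by split; rewrite /I /= in_itv/= -ler_norml (le_trans _ h)// /Num.norm/= le_max lexx ?orbT.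
have mK : measurable (K : set T2).
  rewrite -[K]setCK; apply: measurableC; apply: open_measurable2; apply: closed_openC.
  exact: compact_closed.
have mI : measurable I by exact: measurable_itv.
apply: (@le_lt_trans _ _ (mu2 (I `*` I))).
  by apply: le_measure; rewrite ?inE//; exact: measurableX.
have Ioo : (@lebesgue_measure R I < +oo)%E.
  have := lebesgue_measure_itv `[- (`|M| + 1), `|M| + 1]%R => /= e.
  by rewrite [X in (X < _)%E]e; case: ifP => _; rewrite ?ltry// -EFinB ltry.
rewrite [X in (X < _)%E]product_measure1E//.
by rewrite lte_mul_pinfty// ge0_fin_numE.
Qed.

(** A continuous function vanishing outside a compact set is bounded, and compact sets have
    finite measure. *)
Lemma compact_support_sqint D (K : set (R * R)) f : measurable (D : set T2) -> compact K ->
  continuous f ->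
  (forall p, ~ K p -> f p = 0) -> sqint mu2 D f.
Proof.
move=> mD cK cf f0; have [M hM] := compact_support_bounded cK cf f0.
have mK : measurable (K : set T2).
  rewrite -[K]setCK; apply: measurableC; apply: open_measurable2; apply: closed_openC.
  exact: compact_closed.
have mf : measurable_fun (D : set T2) f by exact: continuous_measurable2.
apply: sqintP => //.
apply: (@le_lt_trans _ _ (\int[mu2]_(p in D) ((M ^+ 2)%:E * (\1_K p)%:E))%E).
  apply: ge0_le_integral => //.
  - by move=> p _; rewrite lee_fin sqr_ge0.
  - by apply/measurable_EFinP; exact: measurable_funX.
  - by apply: measurable_funeM; apply/measurable_EFinP.
  move=> p _; rewrite -EFinM lee_fin indicE.
  have [pK|pK] := boolP (p \in K).
    by rewrite mulr1 -real_normK ?num_real// lerXn2r ?nnegrE// (le_trans (normr_ge0 (f p))).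
  have -> : f p = 0 by apply: f0 => Kp; move: pK; rewrite mem_set.
  by rewrite expr0n mulr0.
rewrite ge0_integralZl ?lee_fin ?sqr_ge0//; last by apply/measurable_EFinP.
rewrite integral_indic// lte_mul_pinfty ?lee_fin ?sqr_ge0//.
rewrite (le_lt_trans _ (compact_finite_measure2 cK))//.
by apply: le_measure; rewrite ?inE//; exact: measurableI.
Qed.
End plane_functions.

(** * Test functions and weak derivatives *)

Section weak_derivatives.
Variable R : realType.
Local Notation T2 := (measurableTypeR R * measurableTypeR R)%type.
Local Notation mu2 := (@lebesgue_measure R \x @lebesgue_measure R)%E.
Local Notation Re := complex.Re.
Local Notation Im := complex.Im.
Implicit Types (D : set (R * R)) (u v : R * R -> R[i]) (f g h phi : R * R -> R).

(** The class [Ck] only speaks of the two partial derivatives, so the lemmas about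
    directional derivatives of smooth functions are restricted to these two directions. *)
Definition axis (e : R * R) := e = ex R \/ e = ey R.

Lemma smoothM f g : smooth f -> smooth g -> smooth (fun p => f p * g p).
Proof. by move=> sf sg n; apply: CkM; [exact: sf|exact: sg]. Qed.

Lemma smooth_derivable e f p : axis e -> smooth f -> derivable f p e.
Proof. by move=> [] -> /(_ 1%N)[_ []]. Qed.

Lemma smooth_continuous f : smooth f -> continuous f.
Proof. by move=> /(_ 0%N)[]. Qed.

Lemma smooth_derive e f : axis e -> smooth f -> smooth (fun p => 'D_e f p).
Proof. by move=> [] -> sf n; have [_ []] := sf n.+1. Qed.

Lemma smooth_deriveM e f g p : axis e -> smooth f -> smooth g ->
  'D_e (fun q => f q * g q) p = f p * 'D_e g p + g p * 'D_e f p.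
Proof.
by move=> he sf sg; rewrite (@deriveM _ _ f g)//; exact: smooth_derivable.
Qed.

Lemma test_funM D phi h : smooth h -> test_fun D phi -> test_fun D (fun p => h p * phi p).
Proof.
move=> sh [sp cp pD].
have sub : closure [set p | h p * phi p != 0] `<=` closure [set p | phi p != 0].
  by apply: closure_subset => p /=; apply: contra_neq => ->; rewrite mulr0.
split; first exact: smoothM.
- by apply: (subclosed_compact _ cp) => //; exact: closed_closure.
- exact: subset_trans pD.
Qed.

Lemma out_support phi p : ~ closure [set p | phi p != 0] p -> phi p = 0.
Proof.
by move=> h; apply/eqP; apply: contra_notT h => h; exact: subset_closure.
Qed.

Lemma derive_out_support e phi p : ~ closure [set p | phi p != 0] p -> 'D_e phi p = 0.
Proof.
move=> h; rewrite (@near_eq_derive _ _ _ _ (cst 0)) ?derive_cst//.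
have oC : open (~` closure [set p | phi p != 0]).
  by apply: closed_openC; exact: closed_closure.
have : nbhs p (~` closure [set p | phi p != 0]) by exact: open_nbhs_nbhs.
by apply: filterS => q; exact: out_support.
Qed.

Lemma test_fun_sqint D D' phi : measurable (D : set T2) -> test_fun D' phi -> sqint mu2 D phi.
Proof.
move=> mD [sp cp pD]; apply: (compact_support_sqint mD cp); first exact: smooth_continuous.
by move=> p; exact: out_support.
Qed.

Lemma test_fun_derive_sqint D D' e phi : axis e -> measurable (D : set T2) -> test_fun D' phi ->
  sqint mu2 D (fun p => 'D_e phi p).
Proof.
move=> he mD [sp cp pD]; apply: (compact_support_sqint mD cp).
  by apply: smooth_continuous; exact: smooth_derive.
by move=> p; exact: derive_out_support.
Qed.

(** The real form of [weak_derivative], in which no complex multiplication occurs. *)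
Definition weak_derivativeR D (e : R * R) f g := forall phi, test_fun D phi ->
  \int[mu2]_(p in D) (f p * 'D_e phi p) = - \int[mu2]_(p in D) (g p * phi p).

Lemma integralCMr D u f : integralC D (fun p => u p * (f p)%:C%C) =
  ((\int[mu2]_(p in D) (Re (u p) * f p)) +i* (\int[mu2]_(p in D) (Im (u p) * f p)))%C.
Proof.
rewrite /integralC; congr (_ +i* _)%C; apply: eq_Rintegral => p _.
  by rewrite Re_mulr_real.
by rewrite Im_mulr_real.
Qed.

Lemma weak_derivativeP D e u v : weak_derivative D e u v <->
  weak_derivativeR D e (fun p => Re (u p)) (fun p => Re (v p)) /\
  weak_derivativeR D e (fun p => Im (u p)) (fun p => Im (v p)).
Proof.
split=> [h|[hr hi] phi tphi]; last by rewrite !integralCMr hr// hi.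
by split=> phi /h; rewrite !integralCMr => -[].
Qed.

(** Leibniz rule: if [phi] is a test function then so is [h * phi], and
    [h * 'D_e phi = 'D_e (h * phi) - 'D_e h * phi]. *)
Lemma weak_derivativeR_mul D e f g h : axis e -> measurable (D : set T2) -> smooth h ->
  sqint mu2 D f -> sqint mu2 D g -> weak_derivativeR D e f g ->
  weak_derivativeR D e (fun p => h p * f p) (fun p => h p * g p + 'D_e h p * f p).
Proof.
move=> he mD sh sf sg hw phi tphi.
have tH := test_funM sh tphi; have [sphi _ _] := tphi.
have tH' := test_funM (smooth_derive he sh) tphi.
have i1 := sqint_integrableM mD sf (test_fun_derive_sqint he mD tH).
have i2 := sqint_integrableM mD sf (test_fun_sqint mD tH').
have i3 := sqint_integrableM mD sg (test_fun_sqint mD tH).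
transitivity (\int[mu2]_(p in D) (f p * 'D_e (fun q => h q * phi q) p) -
    \int[mu2]_(p in D) (f p * ('D_e h p * phi p))).
  rewrite -RintegralB//; apply: eq_Rintegral => p _.
  by rewrite smooth_deriveM//; ring.
rewrite hw// -opprD; congr (- _).
rewrite -RintegralD//; apply: eq_Rintegral => p _; ring.
Qed.
End weak_derivatives.

(** * Multiplication operators on the form domain *)

Section multiplication.
Variable R : realType.
Local Notation T2 := (measurableTypeR R * measurableTypeR R)%type.
Local Notation Re := complex.Re.
Local Notation Im := complex.Im.
Implicit Types (D : set (R * R)) (u v g gx gy w : R * R -> R[i]) (h : R * R -> R).

Lemma L2_bddM D h u (M : R) : measurable (D : set T2) -> continuous h ->
  (forall p, `|h p| <= M) -> L2 D u -> L2 D (fun p => (h p)%:C%C * u p).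
Proof.
move=> mD ch hM /(L2P _ mD)[ur ui]; apply/(L2P _ mD).
have mh : measurable_fun (D : set T2) h by exact: continuous_measurable2.
split.
  under eq_fun do rewrite Re_mull_real; exact: (sqint_bddM mD mh).
under eq_fun do rewrite Im_mull_real; exact: (sqint_bddM mD mh).
Qed.

Lemma L2D D u v : measurable (D : set T2) -> L2 D u -> L2 D v -> L2 D (fun p => u p + v p).
Proof.
move=> mD /(L2P _ mD)[ur ui] /(L2P _ mD)[vr vi]; apply/(L2P _ mD).
split.
  under eq_fun do rewrite raddfD; exact: sqintD.
under eq_fun do rewrite raddfD; exact: sqintD.
Qed.

(** The component along [e] of the gradient of [h * u], by the Leibniz rule, when [g] is the
    component of the gradient of [u]. *)
Definition gradM (e : R * R) h u g : R * R -> R[i] :=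
  fun p => (h p)%:C%C * g p + ('D_e h p)%:C%C * u p.

Lemma Re_gradM e h u g p : Re (gradM e h u g p) = h p * Re (g p) + 'D_e h p * Re (u p).
Proof. by rewrite /gradM raddfD/= !Re_mull_real. Qed.

Lemma Im_gradM e h u g p : Im (gradM e h u g p) = h p * Im (g p) + 'D_e h p * Im (u p).
Proof. by rewrite /gradM raddfD/= !Im_mull_real. Qed.

Lemma weak_derivativeM D e h u g : axis e -> measurable (D : set T2) -> smooth h ->
  L2 D u -> L2 D g -> weak_derivative D e u g ->
  weak_derivative D e (fun p => (h p)%:C%C * u p) (gradM e h u g).
Proof.
move=> he mD sh /(L2P _ mD)[ur ui] /(L2P _ mD)[gr gi] /weak_derivativeP[wr wi].
have := weak_derivativeR_mul he mD sh ur gr wr; have := weak_derivativeR_mul he mD sh ui gi wi.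
rewrite -(funext (Re_gradM e h u g)) -(funext (Im_gradM e h u g)).
rewrite -(funext (fun p => Re_mull_real (u p) (h p))).
rewrite -(funext (fun p => Im_mull_real (u p) (h p))) => hi hr.
exact/weak_derivativeP.
Qed.

(** The multipliers that act on the form domain; a single constant serves as a bound of the
    function and of its gradient. *)
Definition bounded_C1 h (M : R) := [/\ smooth h, forall p, `|h p| <= M,
  forall p, `|'D_(ex R) h p| <= M & forall p, `|'D_(ey R) h p| <= M].

Lemma axis_ex : axis (ex R). Proof. by left. Qed.
Lemma axis_ey : axis (ey R). Proof. by right. Qed.
Hint Resolve axis_ex axis_ey : core.

Lemma H1M D h M u gx gy : measurable (D : set T2) -> bounded_C1 h M -> H1 D u gx gy ->
  H1 D (fun p => (h p)%:C%C * u p) (gradM (ex R) h u gx) (gradM (ey R) h u gy).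
Proof.
move=> mD [sh hM hxM hyM] [Lu Lgx Lgy wx wy].
have ch := smooth_continuous sh.
have chx := smooth_continuous (smooth_derive axis_ex sh).
have chy := smooth_continuous (smooth_derive axis_ey sh).
split; [exact: (L2_bddM mD ch hM)| | |exact: weak_derivativeM|exact: weak_derivativeM].
- by apply: L2D => //; [exact: (L2_bddM mD ch hM)|exact: (L2_bddM mD chx hxM)].
- by apply: L2D => //; [exact: (L2_bddM mD ch hM)|exact: (L2_bddM mD chy hyM)].
Qed.

Lemma Cc_inftyM h w : smooth h -> Cc_infty w -> Cc_infty (fun p => (h p)%:C%C * w p).
Proof.
move=> sh [sr si cw]; split.
- by under eq_fun do rewrite Re_mull_real; exact: smoothM.
- by under eq_fun do rewrite Im_mull_real; exact: smoothM.
apply: (subclosed_compact _ cw); first exact: closed_closure.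
by apply: closure_subset => p /=; apply: contra_neq => ->; rewrite mulr0.
Qed.

Lemma partialCM e h w p : axis e -> smooth h -> Cc_infty w ->
  partialC e (fun p => (h p)%:C%C * w p) p = gradM e h w (partialC e w) p.
Proof.
move=> he sh [sr si _]; apply/eqP; rewrite eq_complex Re_gradM Im_gradM /partialC/=.
rewrite (funext (fun p => Re_mull_real (w p) (h p))).
rewrite (funext (fun p => Im_mull_real (w p) (h p))).
by rewrite !smooth_deriveM// ![_ * 'D_e h p]mulrC !eqxx.
Qed.

Lemma sqnormcMr (r : R) (z : R[i]) : sqnormc (r%:C%C * z) = r ^+ 2 * sqnormc z.
Proof. by rewrite !sqnormcE Re_mull_real Im_mull_real !exprMn mulrDr. Qed.

Lemma sqnormcD_le (z w : R[i]) : sqnormc (z + w) <= 2 * (sqnormc z + sqnormc w).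
Proof.
rewrite !sqnormcE !raddfD/=.
rewrite -subr_ge0 (_ : _ - _ = (Re z - Re w) ^+ 2 + (Im z - Im w) ^+ 2); last by ring.
by rewrite addr_ge0 ?sqr_ge0.
Qed.

Lemma sqnormcMr_le (r M : R) (z : R[i]) : `|r| <= M -> sqnormc (r%:C%C * z) <= M ^+ 2 * sqnormc z.
Proof.
move=> rM; rewrite sqnormcMr ler_wpM2r ?sqnormc_ge0//.
by rewrite -real_normK ?num_real// lerXn2r ?nnegrE// (le_trans (normr_ge0 r)).
Qed.

Lemma sqnormc_gradM_le (a b M : R) (z w : R[i]) : `|a| <= M -> `|b| <= M ->
  sqnormc (a%:C%C * z + b%:C%C * w) <= 2 * M ^+ 2 * (sqnormc z + sqnormc w).
Proof.
move=> aM bM; apply: (le_trans (sqnormcD_le _ _)).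
by rewrite -mulrA ler_wpM2l// mulrDr lerD// sqnormcMr_le.
Qed.

Lemma Cc_infty_measurable D w : measurable (D : set T2) -> Cc_infty w ->
  measurable_fun (D : set T2) (fun p => Re (w p)) /\ measurable_fun (D : set T2) (fun p => Im (w p)).
Proof.
by move=> mD [sr si _]; split; apply: continuous_measurable2 => //; exact: smooth_continuous.
Qed.

Lemma partialC_measurable D e w : axis e -> measurable (D : set T2) -> Cc_infty w ->
  measurable_fun (D : set T2) (fun p => Re (partialC e w p)) /\
  measurable_fun (D : set T2) (fun p => Im (partialC e w p)).
Proof.
move=> he mD [sr si _]; split; apply: continuous_measurable2 => //;
  by apply: smooth_continuous; exact: smooth_derive.
Qed.

Lemma measurable_sqnormcB D u v :
  measurable_fun (D : set T2) (fun p => Re (u p)) /\ measurable_fun (D : set T2) (fun p => Im (u p)) ->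
  measurable_fun (D : set T2) (fun p => Re (v p)) /\ measurable_fun (D : set T2) (fun p => Im (v p)) ->
  measurable_fun (D : set T2) (fun p => sqnormc (u p - v p)).
Proof.
move=> [ur ui] [vr vi]; apply/measurable_EFinP; apply: measurable_sqnormc.
  by under eq_fun do rewrite raddfB; exact: measurable_funB.
by under eq_fun do rewrite raddfB; exact: measurable_funB.
Qed.


(** Multiplication by [h] is bounded in H^1: it carries an approximating sequence of [u] to an
    approximating sequence of [h * u]. *)
Lemma H1_sqnormM_le D h M u gx gy w : measurable (D : set T2) -> bounded_C1 h M ->
  H1 D u gx gy -> Cc_infty w ->
  (H1_sqnorm D (fun p => ((h p)%:C%C * w p - (h p)%:C%C * u p)%R)
    (fun p => (partialC (ex R) (fun p => (h p)%:C%C * w p) p - gradM (ex R) h u gx p)%R)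
    (fun p => (partialC (ey R) (fun p => (h p)%:C%C * w p) p - gradM (ey R) h u gy p)%R) <=
  (5 * M ^+ 2)%:E * H1_sqnorm D (fun p => (w p - u p)%R)
    (fun p => (partialC (ex R) w p - gx p)%R) (fun p => (partialC (ey R) w p - gy p)%R))%E.
Proof.
move=> mD hM Hu Cw; have [sh h0 hx hy] := hM.
have Chw := Cc_inftyM sh Cw.
have m_ u' gx' gy' w' : H1 D u' gx' gy' -> Cc_infty w' ->
    measurable_fun (D : set T2) (fun p => (sqnormc (w' p - u' p)
      + sqnormc (partialC (ex R) w' p - gx' p) + sqnormc (partialC (ey R) w' p - gy' p))%:E).
  move=> [[? ? _] [? ? _] [? ? _] _ _] Cw'; apply/measurable_EFinP.
  apply: measurable_funD; first apply: measurable_funD; apply: measurable_sqnormcB => //.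
  - exact: Cc_infty_measurable.
  - exact: partialC_measurable.
  - exact: partialC_measurable.
rewrite /H1_sqnorm -ge0_integralZl//; last 3 first.
- exact: m_.
- by move=> p _; rewrite lee_fin !addr_ge0 ?sqnormc_ge0.
- by rewrite lee_fin mulr_ge0 ?sqr_ge0.
apply: ge0_le_integral => //.
- by move=> p _; rewrite lee_fin !addr_ge0 ?sqnormc_ge0.
- by apply: m_ => //; exact: H1M hM Hu.
- by apply: measurable_funeM; exact: m_.
move=> p _; rewrite -EFinM lee_fin !partialCM//.
have E e g : gradM e h w (partialC e w) p - gradM e h u g p =
    (h p)%:C%C * (partialC e w p - g p) + ('D_e h p)%:C%C * (w p - u p).
  by rewrite /gradM; ring.
have E0 : (h p)%:C%C * w p - (h p)%:C%C * u p = (h p)%:C%C * (w p - u p).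
  by rewrite mulrBr.
have a0 := sqnormcMr_le (w p - u p) (h0 p).
have ax := sqnormc_gradM_le (partialC (ex R) w p - gx p) (w p - u p) (h0 p) (hx p).
have ay := sqnormc_gradM_le (partialC (ey R) w p - gy p) (w p - u p) (h0 p) (hy p).
rewrite -E0 in a0; rewrite -(E (ex R) gx) in ax; rewrite -(E (ey R) gy) in ay.
apply: (le_trans (lerD (lerD a0 ax) ay)).
move: (sqnormc_ge0 (partialC (ex R) w p - gx p)) (sqnormc_ge0 (partialC (ey R) w p - gy p)).
move: (sqnormc _) (sqnormc _) (sqnormc _) (sqr_ge0 M) => s0 s1 s2; move: (M ^+ 2) => N.
clear; nra.
Qed.

Lemma measurable_sqnormc_row w (y : R) : Cc_infty w ->
  measurable_fun [set: measurableTypeR R] (fun x => (sqnormc (w (x, y) - 0))%:E).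
Proof.
move=> Cw; under eq_fun do rewrite subr0.
have [mr mi] := Cc_infty_measurable (@measurableT _ T2) Cw.
apply: (measurableT_comp (f := fun p : T2 => (sqnormc (w p))%:E)).
  exact: measurable_sqnormc.
exact: pair2_measurable.
Qed.

Lemma dir_sqnormM_le (theta : R) h M w : smooth h -> (forall p, `|h p| <= M) -> Cc_infty w ->
  (dir_sqnorm theta (fun p => (h p)%:C%C * w p - 0)%R <=
  (M ^+ 2)%:E * dir_sqnorm theta (fun p => w p - 0)%R)%E.
Proof.
move=> sh hM Cw; have Chw := Cc_inftyM sh Cw.
have M0 : (0 <= (M ^+ 2)%:E)%E by rewrite lee_fin sqr_ge0.
have mrow v I y : Cc_infty v -> measurable_fun (I : set (measurableTypeR R))
    (fun x => (sqnormc (v (x, y) - 0))%:E).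
  by move=> Cv; apply: measurable_funTS; exact: measurable_sqnormc_row.
have key (I : set (measurableTypeR R)) y : measurable I ->
    (\int[@lebesgue_measure R]_(x in I) (sqnormc ((h (x, y))%:C%C * w (x, y) - 0))%:E <=
    (M ^+ 2)%:E * \int[@lebesgue_measure R]_(x in I) (sqnormc (w (x, y) - 0))%:E)%E.
  move=> mI; rewrite -ge0_integralZl//; last 2 first.
  - exact: mrow.
  - by move=> x _; rewrite lee_fin sqnormc_ge0.
  apply: ge0_le_integral => //.
  - by move=> x _; rewrite lee_fin sqnormc_ge0.
  - exact: (mrow (fun p => (h p)%:C%C * w p)).
  - by apply: measurable_funeM; exact: mrow.
  - by move=> x _; rewrite -EFinM lee_fin !subr0; exact: sqnormcMr_le.
have pos (I : set (measurableTypeR R)) y v :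
    (0 <= \int[@lebesgue_measure R]_(x in I) (sqnormc (v (x, y) - 0))%:E)%E.
  by apply: integral_ge0 => x _; rewrite lee_fin sqnormc_ge0.
rewrite /dir_sqnorm ge0_muleDr; [|exact: (pos _ 0 w)|exact: (pos _ pi w)].
by apply: leeD; apply: key; exact: measurable_itv.
Qed.

Lemma measurable_Omega (theta : R) : measurable (Omega theta : set T2).
Proof.
have mfst : measurable_fun [set: T2] (fst : T2 -> R) by exact: measurable_fst.
have msnd : measurable_fun [set: T2] (snd : T2 -> R) by exact: measurable_snd.
have mlt (f g : T2 -> R) : measurable_fun setT f -> measurable_fun setT g ->
    measurable [set p : T2 | f p < g p].
  move=> mf mg; rewrite -[X in measurable X]setTI.
  exact: (measurable_fun_ltr mf mg measurableT (Y := [set true])).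
have -> : Omega theta = [set p : T2 | - (pi / tan theta) < p.1] `&` [set p : T2 | 0 < p.2]
    `&` [set p : T2 | p.2 < pi]
    `&` (~` [set p : T2 | p.1 < 0] `|` [set p : T2 | p.2 < p.1 * tan theta + pi]).
  apply/seteqP; split=> [p [h1 h2 h3 h4]|p [[[h1 h2] h3] h4]].
    split; [by []|have [/h4|] := pselect (p.1 < 0); by [right|left]].
  by split=> // hp; case: h4.
apply: measurableI; first (apply: measurableI; first apply: measurableI).
- by apply: mlt.
- by apply: mlt.
- by apply: mlt.
apply: measurableU; first by apply: measurableC; apply: mlt.
apply: mlt => //; apply: measurable_funD => //; exact: measurable_funM.
Qed.

Lemma squeeze_cvge0 (X Y : nat -> \bar R) (C : R) : (forall n, (0 <= X n)%E) ->
  (forall n, (X n <= C%:E * Y n)%E) -> (Y n @[n --> \oo] --> 0%E) -> (X n @[n --> \oo] --> 0%E).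
Proof.
move=> X0 XY Y0.
apply: (@squeeze_cvge _ _ _ _ (fun=> 0%E) _ (fun n => C%:E * Y n)%E).
- by near=> n; rewrite X0 XY.
- exact: cvg_cst.
- by rewrite -[X in _ --> X](mule0 C%:E); exact: cvgeZl.
Unshelve. all: by end_near. Qed.

(** Multiplication by a smooth function that is bounded along with its gradient preserves the
    form domain: it preserves the approximating sequences that define the Dirichlet trace. This
    makes the weighted eigenfunction an admissible test function. *)
Lemma mix_form_domainM (theta : R) h M u gx gy : bounded_C1 h M ->
  mix_form_domain theta u gx gy ->
  mix_form_domain theta (fun p => (h p)%:C%C * u p) (gradM (ex R) h u gx) (gradM (ey R) h u gy).
Proof.
move=> hM [Hu [w [Cw wu wt]]]; have mO := measurable_Omega theta.
split; first exact: (H1M mO hM Hu).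
have [sh h0 _ _] := hM.
exists (fun n p => (h p)%:C%C * w n p); split.
- by move=> n; exact: Cc_inftyM.
- apply: (squeeze_cvge0 _ (fun n => H1_sqnormM_le mO hM Hu (Cw n)) wu).
  by move=> n; apply: integral_ge0 => p _; rewrite lee_fin !addr_ge0 ?sqnormc_ge0.
- apply: (squeeze_cvge0 _ (fun n => dir_sqnormM_le theta sh h0 (Cw n)) wt).
  move=> n; apply: adde_ge0; apply: integral_ge0 => x _; rewrite lee_fin; exact: sqnormc_ge0.
Qed.

End multiplication.

(** * The Poincare inequality on the half-strip *)

Section strip.
Variable R : realType.
Local Notation T1 := (measurableTypeR R).
Local Notation T2 := (measurableTypeR R * measurableTypeR R)%type.
Local Notation mu1 := (@lebesgue_measure R).
Local Notation mu2 := (@lebesgue_measure R \x @lebesgue_measure R)%E.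
Implicit Types (D : set (R * R)) (u v g gx gy w : R * R -> R[i]) (h : R * R -> R).

(** The part of the domain on which the horizontal sides at heights 0 and pi both carry
    the Dirichlet condition. *)
Definition strip : set (R * R) := [set p | [/\ 0 < p.1, 0 < p.2 & p.2 < pi]].

Lemma stripE : strip = ([set` `]0%R, +oo[%R] : set R) `*` ([set` `]0%R, pi[%R] : set R).
Proof.
apply/seteqP; split=> [p [h1 h2 h3]|p [/=]].
  by split; rewrite /= in_itv/= ?h1 ?h2.
by rewrite !in_itv/= andbT => h1 /andP[h2 h3].
Qed.

Lemma measurable_strip : measurable (strip : set T2).
Proof. by rewrite stripE; apply: measurableX; exact: measurable_itv. Qed.

Lemma Omega_left_lt0 (theta : R) : 0 < theta < pi / 2 -> - (pi / tan theta) < 0.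
Proof.
move=> /andP[t0 t1]; have pi0 := @pi_gt0 R.
have sin0 : 0 < sin theta by apply: sin_gt0_pi; apply/andP; split=> //; lra.
have cos0 : 0 < cos theta by apply: cos_gt0_pihalf; apply/andP; split=> //; lra.
by rewrite oppr_lt0 divr_gt0// divr_gt0.
Qed.

Lemma strip_Omega (theta : R) : 0 < theta < pi / 2 -> strip `<=` Omega theta.
Proof.
move=> ht p [h1 h2 h3]; split=> //; last by move=> /lt_trans /(_ h1); rewrite ltxx.
exact: lt_trans (Omega_left_lt0 ht) h1.
Qed.

(** Used in both directions: to apply one-dimensional inequalities on vertical segments, and
    to read the final estimate as an iterated integral. *)
Lemma tonelli_strip (f : T2 -> \bar R) : measurable_fun (strip : set T2) f ->
  (forall p, strip p -> (0 <= f p)%E) ->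
  (\int[mu2]_(p in strip) f p =
   \int[mu1]_(x in `]0%R, +oo[) \int[mu1]_(y in `]0%R, pi[) f (x, y))%E.
Proof.
move=> mf f0; rewrite integral_mkcond fubini_tonelli1; last 2 first.
- by apply/(measurable_restrictT _ _).1 => //; exact: measurable_strip.
- by move=> p; rewrite patchE; case: ifPn => //; rewrite inE => /f0.
rewrite [RHS]integral_mkcond; apply: eq_integral => x _.
rewrite /fubini_F patchE; case: ifPn => x0.
  rewrite [RHS]integral_mkcond; apply: eq_integral => y _.
  rewrite !patchE stripE; congr (if _ then _ else _).
  apply/idP/idP; rewrite !inE/=; first by case.
  by move=> ?; split => //; move: x0; rewrite inE.
transitivity (0%E : \bar R); last by [].
apply: integral0_eq => y _.
rewrite patchE stripE ifF//; apply/negP; rewrite inE => -[/= h _].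
by move: x0; rewrite notin_setE/= h.
Qed.

(** Vertical partial derivatives are derivatives of the restrictions to vertical lines. *)
Lemma is_derive_row (f : R * R -> R) (x y d : R) : is_derive (x, y) (ey R) f d ->
  is_derive y 1 (fun t => f (x, t)) d.
Proof.
pose fx (t : R) : R := f (x, t).
have E : (fun h : R => h^-1 *: ((fx \o shift y) (h *: (1 : R)) - fx y)) =
    (fun h : R => h^-1 *: ((f \o shift (x, y)) (h *: ey R) - f (x, y))).
  apply/funext => h; congr (_ *: (f _ - _)).
  by rewrite /= /shift/= /ey; congr pair; rewrite /= /GRing.scale/= mulr0 add0r.
by case; rewrite -/fx /derivable /derive -E => ? ?; split.
Qed.

Lemma measurable_row_integral (I : set T1) (f : T2 -> \bar R) : measurable I ->
  measurable_fun [set: T2] f -> (forall p, (0 <= f p)%E) ->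
  measurable_fun [set: T1] (fun x => \int[mu1]_(y in I) f (x, y))%E.
Proof.
move=> mI mf f0; pose g := f \_ (setT `*` I).
have mTI : measurable (setT `*` I : set T2) by exact: measurableX.
have mg : measurable_fun [set: T2] g.
  by apply/(measurable_restrictT _ _).1 => //; exact: measurable_funTS.
have g0 p : (0 <= g p)%E by rewrite /g patchE; case: ifPn.
have := measurable_fun_fubini_tonelli_F (m2 := mu1) g mg g0.
congr (measurable_fun _ _); apply/funext => x.
rewrite /fubini_F [RHS]integral_mkcond; apply: eq_integral => y _.
rewrite /g !patchE; congr (if _ then _ else _).
by apply/idP/idP; rewrite !inE/=; [case|].
Qed.

Lemma poincare_row (k x : R) w : 0 < k < 1 -> Cc_infty w ->
  (\int[mu1]_(y in `]0%R, pi[) (k ^+ 2 * sqnormc (w (x, y)))%:E <=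
   \int[mu1]_(y in `]0%R, pi[) (sqnormc (partialC (ey R) w (x, y)))%:E +
   (k * tan (k * (pi / 2)) * (sqnormc (w (x, 0)) + sqnormc (w (x, pi))))%:E)%E.
Proof.
move=> hk [sr si _].
have crow (f : R * R -> R) : continuous f -> continuous (fun y => f (x, y)).
  move=> cf y; apply: (@continuous_comp _ _ _ (fun y : R => (x, y)) f); last exact: cf.
  exact: (cvg_pair (cvg_cst x) cvg_id).
have msq (I : set T1) (g : R -> R) (c : R) : measurable I -> continuous g ->
    measurable_fun I (fun y => (c * g y ^+ 2)%:E).
  move=> mI cg; apply/measurable_EFinP; apply: measurable_funTS; apply: measurable_funM => //.
  by apply: measurable_funX; exact: continuous_measurable_fun.
have msq1 (I : set T1) (g : R -> R) : measurable I -> continuous g ->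
    measurable_fun I (fun y => (g y ^+ 2)%:E).
  by move=> mI /(msq I _ 1 mI); under eq_fun do rewrite mul1r.
have mI : measurable ([set` `]0%R, pi[%R] : set T1) by exact: measurable_itv.
have P (f : R * R -> R) : smooth f ->
  (\int[mu1]_(y in `]0%R, pi[) (k ^+ 2 * f (x, y) ^+ 2)%:E <=
   \int[mu1]_(y in `]0%R, pi[) ('D_(ey R) f (x, y) ^+ 2)%:E +
   (k * tan (k * (pi / 2)) * (f (x, 0%R) ^+ 2 + f (x, pi) ^+ 2))%:E)%E.
  move=> sf.
  have cf := crow _ (smooth_continuous sf).
  have cf' := crow _ (smooth_continuous (smooth_derive (axis_ey R) sf)).
  have := @poincare_itv R k (fun y => f (x, y)) (fun y => 'D_(ey R) f (x, y)) hk _ cf'.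
  rewrite (@integral_itv_bndoo _ _ _ _ true false (msq _ _ _ mI cf)).
  rewrite (@integral_itv_bndoo _ _ _ _ true false (msq1 _ _ mI cf')); apply => y.
  by apply: is_derive_row; apply: derivableP; exact: smooth_derivable (axis_ey R) sf.
have Pr := P _ sr; have Pi := P _ si.
have cr := crow _ (smooth_continuous sr); have ci := crow _ (smooth_continuous si).
have cr' := crow _ (smooth_continuous (smooth_derive (axis_ey R) sr)).
have ci' := crow _ (smooth_continuous (smooth_derive (axis_ey R) si)).
have := leeD Pr Pi; rewrite -ge0_integralD//; last 4 first.
- by move=> y _; rewrite lee_fin mulr_ge0 ?sqr_ge0.
- exact: msq.
- by move=> y _; rewrite lee_fin mulr_ge0 ?sqr_ge0.
- exact: msq.
rewrite addeACA -ge0_integralD//; last 4 first.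
- by move=> y _; rewrite lee_fin sqr_ge0.
- exact: msq1.
- by move=> y _; rewrite lee_fin sqr_ge0.
- exact: msq1.
congr (_ <= _ + _)%E.
- by apply: eq_integral => y _; rewrite -EFinD -mulrDr sqnormcE.
- by apply: eq_integral => y _; rewrite -EFinD sqnormcE.
- by rewrite -EFinD -mulrDr !sqnormcE; congr (_ * _)%:E; ring.
Qed.

Lemma poincareC_ge0 (k : R) : 0 < k < 1 -> 0 <= k * tan (k * (pi / 2)).
Proof.
move=> /andP[k0 k1]; have pi0 := @pi_gt0 R.
have l0 : 0 < k * (pi / 2) by rewrite mulr_gt0// divr_gt0.
have l1 : k * (pi / 2) < pi / 2 by rewrite gtr_pMl// divr_gt0.
rewrite mulr_ge0 ?(ltW k0)// divr_ge0//.
  by rewrite ltW// sin_gt0_pi//; apply/andP; split=> //; lra.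
by rewrite ltW// cos_gt0_pihalf//; apply/andP; split=> //; lra.
Qed.

(** [poincare_row] on almost every vertical segment, integrated against a weight that depends
    on the abscissa only. The boundary values are controlled by the norm in which the Dirichlet
    traces converge. *)
Lemma strip_poincare (theta k M : R) (rho : R -> R) w : 0 < theta < pi / 2 -> 0 < k < 1 ->
  continuous rho -> (forall x, 0 <= rho x <= M) -> Cc_infty w ->
  (\int[mu2]_(p in strip) (rho p.1 * (k ^+ 2 * sqnormc (w p)))%:E <=
   \int[mu2]_(p in strip) (rho p.1 * sqnormc (partialC (ey R) w p))%:E +
   (M * (k * tan (k * (pi / 2))))%:E * dir_sqnorm theta (fun p => (w p - 0)%R))%E.
Proof.
move=> ht hk crho hrho Cw.
have rho0 x : 0 <= rho x by have /andP[] := hrho x.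
have rhoM x : rho x <= M by have /andP[] := hrho x.
have K0 := poincareC_ge0 hk; set K := k * tan _ in K0 *.
have M0 : 0 <= M by apply: le_trans (rhoM 0).
have [mr mi] := Cc_infty_measurable (@measurableT _ T2) Cw.
have [mr' mi'] := partialC_measurable (axis_ey R) (@measurableT _ T2) Cw.
have ms : measurable_fun [set: T2] (fun p => sqnormc (w p)).
  by apply/measurable_EFinP; exact: measurable_sqnormc.
have ms' : measurable_fun [set: T2] (fun p => sqnormc (partialC (ey R) w p)).
  by apply/measurable_EFinP; exact: measurable_sqnormc.
have mrho1 : measurable_fun [set: T1] rho by exact: continuous_measurable_fun.
have mrho : measurable_fun [set: T2] (fun p => rho p.1) by exact: measurableT_comp.
have mL : measurable_fun [set: T2] (fun p => (rho p.1 * (k ^+ 2 * sqnormc (w p)))%:E).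
  by apply/measurable_EFinP; apply: measurable_funM => //; exact: measurable_funM.
have mS : measurable_fun [set: T2] (fun p => (rho p.1 * sqnormc (partialC (ey R) w p))%:E).
  by apply/measurable_EFinP; exact: measurable_funM.
have L0 p : (0 <= (rho p.1 * (k ^+ 2 * sqnormc (w p)))%:E)%E.
  by rewrite lee_fin (mulr_ge0 (rho0 _) (mulr_ge0 (sqr_ge0 _) (sqnormc_ge0 _))).
have S0 p : (0 <= (rho p.1 * sqnormc (partialC (ey R) w p))%:E)%E.
  by rewrite lee_fin mulr_ge0 ?sqnormc_ge0.
have mI : measurable ([set` `]0%R, pi[%R] : set T1) by exact: measurable_itv.
have mJ : measurable ([set` `]0%R, +oo[%R] : set T1) by exact: measurable_itv.
rewrite !tonelli_strip//; try exact: measurable_funTS.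
have mrow y : measurable_fun [set: T1] (fun x => (sqnormc (w (x, y)))%:E).
  by have := measurable_sqnormc_row y Cw; under eq_fun do rewrite subr0.
have mB : measurable_fun [set: T1]
    (fun x => (rho x * (K * (sqnormc (w (x, 0)) + sqnormc (w (x, pi)))))%:E).
  apply/measurable_EFinP; apply: measurable_funM => //; apply: measurable_funM => //.
  by apply: measurable_funD; apply/measurable_EFinP; exact: mrow.
have B0 x : (0 <= (rho x * (K * (sqnormc (w (x, 0)) + sqnormc (w (x, pi)))))%:E)%E.
  by rewrite lee_fin (mulr_ge0 (rho0 _)) ?(mulr_ge0 K0) ?addr_ge0 ?sqnormc_ge0.
have msec (f : T2 -> R) x : measurable_fun [set: T2] f ->
    measurable_fun ([set` `]0%R, pi[%R] : set T1) (fun y => (f (x, y))%:E).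
  move=> mf; apply/measurable_EFinP; apply: measurable_funTS.
  exact: (measurableT_comp mf (pair1_measurable x)).
have row x : (\int[mu1]_(y in `]0%R, pi[) (rho x * (k ^+ 2 * sqnormc (w (x, y))))%:E <=
    \int[mu1]_(y in `]0%R, pi[) (rho x * sqnormc (partialC (ey R) w (x, y)))%:E +
    (rho x * (K * (sqnormc (w (x, 0)) + sqnormc (w (x, pi)))))%:E)%E.
  under eq_integral do rewrite EFinM.
  under [X in (_ <= X + _)%E]eq_integral do rewrite EFinM.
  rewrite !ge0_integralZl//.
  - rewrite [X in (_ <= _ + X)%E]EFinM -ge0_muleDr; last 2 first.
    + by apply: integral_ge0 => y _; rewrite lee_fin sqnormc_ge0.
    + by rewrite lee_fin (mulr_ge0 K0) ?addr_ge0 ?sqnormc_ge0.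
    apply: lee_wpmul2l; first by rewrite lee_fin.
    exact: poincare_row.
  - exact: (msec (fun p => sqnormc (partialC (ey R) w p))).
  - by move=> y _; rewrite lee_fin sqnormc_ge0.
  - by rewrite lee_fin.
  - by apply: (msec (fun p => k ^+ 2 * sqnormc (w p))); exact: measurable_funM.
  - by move=> y _; rewrite lee_fin (mulr_ge0 (sqr_ge0 _)) ?sqnormc_ge0.
  - by rewrite lee_fin.
apply: (@le_trans _ _ (\int[mu1]_(x in `]0%R, +oo[)
    (\int[mu1]_(y in `]0%R, pi[) (rho x * sqnormc (partialC (ey R) w (x, y)))%:E +
    (rho x * (K * (sqnormc (w (x, 0)) + sqnormc (w (x, pi)))))%:E))%E).
  apply: ge0_le_integral => //.
  - by move=> x _; exact: integral_ge0.
  - by apply: measurable_funTS; exact: (measurable_row_integral mI mL L0).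
  - apply: emeasurable_funD; last exact: measurable_funTS.
    by apply: measurable_funTS; exact: (measurable_row_integral mI mS S0).
  - by move=> x _; exact: row.
rewrite ge0_integralD//; last 3 first.
- by move=> x _; apply: integral_ge0 => y _; exact: (S0 (x, y)).
- by apply: measurable_funTS; exact: (measurable_row_integral mI mS S0).
- exact: measurable_funTS.
apply: leeD => //.
have H0 : (forall y, 0 <= \int[mu1]_(x in `]0%R, +oo[) (sqnormc (w (x, y)))%:E)%E.
  by move=> y; apply: integral_ge0 => x _; rewrite lee_fin sqnormc_ge0.
have mrow' I y : measurable_fun (I : set T1) (fun x => (sqnormc (w (x, y)))%:E).
  by apply: measurable_funTS; exact: mrow.
apply: (@le_trans _ _ ((M * K)%:E * (\int[mu1]_(x in `]0%R, +oo[) (sqnormc (w (x, 0%R)))%:E +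
   \int[mu1]_(x in `]0%R, +oo[) (sqnormc (w (x, pi)))%:E))%E).
  rewrite -ge0_integralD//; last 2 first.
  - by move=> x _; rewrite lee_fin sqnormc_ge0.
  - by move=> x _; rewrite lee_fin sqnormc_ge0.
  rewrite -ge0_integralZl//; last 3 first.
  - by apply: emeasurable_funD.
  - by move=> x _; rewrite -EFinD lee_fin addr_ge0 ?sqnormc_ge0.
  - by rewrite lee_fin mulr_ge0.
  apply: ge0_le_integral => //.
  - exact: measurable_funTS.
  - by apply: measurable_funeM; apply: emeasurable_funD.
  - by move=> x _; rewrite -EFinD -EFinM lee_fin mulrA ler_wpM2r ?addr_ge0 ?sqnormc_ge0// ler_wpM2r.
apply: lee_wpmul2l; first by rewrite lee_fin mulr_ge0.
rewrite /dir_sqnorm; under [X in (_ <= X + _)%E]eq_integral do rewrite subr0.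
under [X in (_ <= _ + X)%E]eq_integral do rewrite subr0.
apply: leeD => //; apply: ge0_subset_integral => //.
- by move=> x _; rewrite lee_fin sqnormc_ge0.
- move=> x /=; rewrite !in_itv/= !andbT => x0.
  exact: lt_trans (Omega_left_lt0 ht) x0.
Qed.
End strip.

(** * The Poincare inequality on the form domain *)

Section form_poincare.
Variable R : realType.
Local Notation T2 := (measurableTypeR R * measurableTypeR R)%type.
Local Notation mu2 := (@lebesgue_measure R \x @lebesgue_measure R)%E.
Local Notation Re := complex.Re.
Local Notation Im := complex.Im.
Local Notation S := (@strip R).
Implicit Types (D : set (R * R)) (u v g gx gy w : R * R -> R[i]) (h : R * R -> R).

Definition measurable_cfun D u := measurable_fun (D : set T2) (fun p => Re (u p)) /\
  measurable_fun (D : set T2) (fun p => Im (u p)).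

Lemma sqnormc_young (eta : R) (a b : R[i]) : 0 < eta ->
  sqnormc a <= (1 + eta) * sqnormc b + (1 + eta^-1) * sqnormc (a - b).
Proof.
move=> eta0; rewrite !sqnormcE !raddfB/=.
move: (Re a) (Im a) (Re b) (Im b) => a1 a2 b1 b2.
have key (x y : R) : x ^+ 2 <= (1 + eta) * y ^+ 2 + (1 + eta^-1) * (x - y) ^+ 2.
  rewrite -subr_ge0 (_ : _ - _ = eta^-1 * (eta * y - (x - y)) ^+ 2).
    by rewrite mulr_ge0 ?sqr_ge0// invr_ge0 ltW.
  by field; rewrite gt_eqF.
apply: (le_trans (lerD (key a1 b1) (key a2 b2))); lra.
Qed.

Lemma sqnormcN (z : R[i]) : sqnormc (- z) = sqnormc z.
Proof. by rewrite !sqnormcE !raddfN !sqrrN. Qed.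

(** Exchanges a function with an approximation in weighted integrals, at the cost of a factor
    close to 1 and of a large multiple of the distance. It avoids square roots and works with
    integrals that may a priori be infinite. *)
Lemma strip_young (eta M c : R) (rho : R -> R) u v : 0 < eta -> 0 <= c <= 1 ->
  continuous rho -> (forall x, 0 <= rho x <= M) -> measurable_cfun S u -> measurable_cfun S v ->
  (\int[mu2]_(p in S) (rho p.1 * (c * sqnormc (u p)))%:E <=
   (1 + eta)%:E * \int[mu2]_(p in S) (rho p.1 * (c * sqnormc (v p)))%:E +
   ((1 + eta^-1) * M)%:E * \int[mu2]_(p in S) (sqnormc (v p - u p))%:E)%E.
Proof.
move=> eta0 /andP[c0 c1] crho hrho mu mv.
have mS : measurable (S : set T2) by exact: measurable_strip.
have rho0 x : 0 <= rho x by have /andP[] := hrho x.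
have rhoM x : rho x <= M by have /andP[] := hrho x.
have M0 : 0 <= M by apply: le_trans (rhoM 0).
have mrho : measurable_fun (S : set T2) (fun p => rho p.1).
  apply: measurable_funTS; apply: (@measurableT_comp _ _ _ _ _ _ rho) => //.
  exact: continuous_measurable_fun.
have mm w : measurable_cfun S w -> measurable_fun (S : set T2) (fun p => (rho p.1 * (c * sqnormc (w p)))%:E).
  move=> [mr mi]; apply/measurable_EFinP; apply: measurable_funM => //; apply: measurable_funM => //.
  by apply/measurable_EFinP; exact: measurable_sqnormc.
have p0 (z : R[i]) x : 0 <= rho x * (c * sqnormc z).
  by rewrite (mulr_ge0 (rho0 _)) ?(mulr_ge0 c0) ?sqnormc_ge0.
have e1 : 0 <= 1 + eta by lra.
have e2 : 0 <= 1 + eta^-1 by rewrite addr_ge0// invr_ge0 ltW.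
have md : measurable_fun (S : set T2) (fun p => (sqnormc (v p - u p))%:E).
  by apply/measurable_EFinP; exact: measurable_sqnormcB.
rewrite -ge0_integralZl//; last 2 first.
- exact: mm.
- by move=> p _; rewrite lee_fin.
rewrite -ge0_integralZl//; last 2 first.
- by move=> p _; rewrite lee_fin sqnormc_ge0.
- by rewrite lee_fin mulr_ge0.
rewrite -ge0_integralD//; last 4 first.
- by move=> p _; rewrite -EFinM lee_fin mulr_ge0.
- by apply: measurable_funeM; exact: mm.
- by move=> p _; rewrite -EFinM lee_fin (mulr_ge0 (mulr_ge0 e2 M0)) ?sqnormc_ge0.
- exact: measurable_funeM.
apply: ge0_le_integral => //.
- by move=> p _; rewrite lee_fin.
- exact: mm.
- by apply: emeasurable_funD; apply: measurable_funeM => //; exact: mm.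
move=> p _; rewrite -!EFinM -EFinD lee_fin.
have y := sqnormc_young (u p) (v p) eta0.
rewrite -(sqnormcN (v p - u p)) opprB.
have d0 := sqnormc_ge0 (u p - v p).
apply: (@le_trans _ _ (rho p.1 * c * ((1 + eta) * sqnormc (v p) + (1 + eta^-1) * sqnormc (u p - v p)))).
  by rewrite mulrA ler_wpM2l// mulr_ge0.
have rc : rho p.1 * c <= M.
  by rewrite (le_trans _ (rhoM p.1))// ler_piMr.
have := ler_wpM2r (mulr_ge0 e2 d0) rc.
rewrite [_ * _ * (_ + _)]mulrDr => h.
by apply: lerD; [rewrite le_eqVlt; apply/orP; left; apply/eqP; ring|rewrite mulrAC mulrC in h *; lra].
Qed.

(** Arithmetic of the passage to the limit in [form_strip_poincare]: [U] and [A] are the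
    weighted norms of the function and of its approximation, [G] and [B] those of their vertical
    derivatives, and [E] and [D] the errors, which tend to 0. *)
Lemma chain_estimate (a c d : R) (U A B G E D : \bar R) : 0 <= a -> 0 <= c -> 0 <= d ->
  (0 <= B -> 0 <= G -> 0 <= E -> 0 <= D ->
   U <= a%:E * A + c%:E * E -> A <= B + d%:E * D -> B <= a%:E * G + c%:E * E ->
   U <= (a ^+ 2)%:E * G + ((a * c + c)%:E * E + (a * d)%:E * D))%E.
Proof.
move=> a0 c0 d0 B0 G0 E0 D0 hU hA hB.
have ea0 : (0 <= a%:E)%E by rewrite lee_fin.
have ec0 : (0 <= c%:E)%E by rewrite lee_fin.
have ed0 : (0 <= d%:E)%E by rewrite lee_fin.
apply: (le_trans hU).
apply: (@le_trans _ _ (a%:E * (a%:E * G + c%:E * E + d%:E * D) + c%:E * E)%E).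
  by rewrite leeD2r// lee_wpmul2l// (le_trans hA)// leeD2r.
have aG : (0 <= a%:E * G)%E by exact: mule_ge0.
have cE : (0 <= c%:E * E)%E by exact: mule_ge0.
have dD : (0 <= d%:E * D)%E by exact: mule_ge0.
rewrite (ge0_muleDr _ (adde_ge0 aG cE) dD) (ge0_muleDr _ aG cE) !muleA -!EFinM.
rewrite [in X in (_ <= X)%E]EFinD ge0_muleDl ?lee_fin ?mulr_ge0// expr2.
by rewrite -!addeA [(_ * D + _)%E]addeC.
Qed.

(** [strip_poincare] passes to the limit along the sequence that defines the trace: the
    boundary terms tend to 0, which is the only place where the Dirichlet condition enters.
    The loss in the constant, from [k] to [s < k], absorbs the factors [1 + eta] of
    [strip_young]. *)
Lemma form_strip_poincare (theta s M : R) (rho : R -> R) u gx gy : 0 < theta < pi / 2 ->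
  0 < s < 1 -> continuous rho -> (forall x, 0 <= rho x <= M) ->
  mix_form_domain theta u gx gy ->
  (\int[mu2]_(p in S) (s ^+ 2 * (rho p.1 * sqnormc (u p)))%:E <=
   \int[mu2]_(p in S) (rho p.1 * sqnormc (gy p))%:E)%E.
Proof.
move=> ht /andP[s0 s1] crho hrho [[Lu Lgx Lgy _ _] [w [Cw wu wt]]].
have rho0 x : 0 <= rho x by have /andP[] := hrho x.
have rhoM x : rho x <= M by have /andP[] := hrho x.
have M0 : 0 <= M by apply: le_trans (rhoM 0).
(* These choices give [s * (1 + eta) <= k < 1]. *)
pose k := (1 + s) / 2; pose eta := (1 - s) / 2.
have hk : 0 < k < 1 by apply/andP; rewrite /k; split; lra.
have eta0 : 0 < eta by rewrite /eta; lra.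
have mS : measurable (S : set T2) by exact: measurable_strip.
have SO := strip_Omega ht.
have mOS (f : R * R -> R) : measurable_fun (Omega theta : set T2) f -> measurable_fun (S : set T2) f.
  by apply: measurable_funS => //; exact: measurable_Omega.
have mL2 v : L2 (Omega theta) v -> measurable_cfun S v.
  by move=> [mr mi _]; split; exact: mOS.
have mw n := Cc_infty_measurable mS (Cw n).
have mwy n := partialC_measurable (axis_ey R) mS (Cw n).
pose E n := H1_sqnorm (Omega theta) (fun p => w n p - u p)
          (fun p => partialC (ex R) (w n) p - gx p)
          (fun p => partialC (ey R) (w n) p - gy p).
pose Dn n := dir_sqnorm theta (fun p => w n p - 0).
have E0 n : (0 <= E n)%E.
  by apply: integral_ge0 => p _; rewrite lee_fin !addr_ge0 ?sqnormc_ge0.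
have D0 n : (0 <= Dn n)%E.
  by apply: adde_ge0; apply: integral_ge0 => x _; rewrite lee_fin sqnormc_ge0.
have mE n : measurable_fun (Omega theta : set T2) (fun p => (sqnormc (w n p - u p) +
    sqnormc (partialC (ex R) (w n) p - gx p) + sqnormc (partialC (ey R) (w n) p - gy p))%:E).
  have mO := measurable_Omega theta.
  move: Lu Lgx Lgy => [? ? _] [? ? _] [? ? _]; apply/measurable_EFinP.
  apply: measurable_funD; first apply: measurable_funD; apply: measurable_sqnormcB => //.
  - exact: Cc_infty_measurable.
  - by apply: partialC_measurable => //; left.
  - by apply: partialC_measurable => //; right.
have subE n (f : T2 -> R) : measurable_fun (S : set T2) f ->
    (forall p, 0 <= f p <= sqnormc (w n p - u p) +
    sqnormc (partialC (ex R) (w n) p - gx p) + sqnormc (partialC (ey R) (w n) p - gy p)) ->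
    (\int[mu2]_(p in S) (f p)%:E <= E n)%E.
  move=> mf hf; rewrite /E /H1_sqnorm.
  apply: (@le_trans _ _ (\int[mu2]_(p in S) ((sqnormc (w n p - u p) +
    sqnormc (partialC (ex R) (w n) p - gx p) + sqnormc (partialC (ey R) (w n) p - gy p))%:E))%E).
    apply: ge0_le_integral => //.
    - by move=> p _; rewrite lee_fin; case/andP: (hf p).
    - exact/measurable_EFinP.
    - by apply/measurable_EFinP; apply: mOS; apply/measurable_EFinP; exact: mE.
    - by move=> p _; rewrite lee_fin; case/andP: (hf p).
  apply: ge0_subset_integral => //; first exact: measurable_Omega.
  by move=> p _; rewrite lee_fin !addr_ge0 ?sqnormc_ge0.
pose C1 := (1 + eta^-1) * M; pose C2 := M * (k * tan (k * (pi / 2))).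
have C10 : 0 <= C1 by rewrite mulr_ge0// addr_ge0// invr_ge0 ltW.
have C20 : 0 <= C2 by rewrite mulr_ge0// poincareC_ge0.
have k2 : 0 <= k ^+ 2 <= 1 by rewrite /k; apply/andP; split; nra.
pose U := (\int[mu2]_(p in S) (rho p.1 * (k ^+ 2 * sqnormc (u p)))%:E)%E.
pose G := (\int[mu2]_(p in S) (rho p.1 * (1 * sqnormc (gy p)))%:E)%E.
have G0 : (0 <= G)%E.
  by apply: integral_ge0 => p _; rewrite lee_fin mul1r mulr_ge0// sqnormc_ge0.
have main n : (U <= ((1 + eta) ^+ 2)%:E * G +
    (((1 + eta) * C1 + C1)%:E * E n + ((1 + eta) * C2)%:E * Dn n))%E.
  apply: (@chain_estimate _ _ _ _ (\int[mu2]_(p in S) (rho p.1 * (k ^+ 2 * sqnormc (w n p)))%:E)%E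
    (\int[mu2]_(p in S) (rho p.1 * (1 * sqnormc (partialC (ey R) (w n) p)))%:E)%E) => //.
  - by rewrite addr_ge0// ltW.
  - by apply: integral_ge0 => p _; rewrite lee_fin mul1r mulr_ge0// sqnormc_ge0.
  - apply: (le_trans (strip_young eta0 k2 crho hrho (mL2 _ Lu) (mw n))).
    rewrite leeD2l// lee_wpmul2l ?lee_fin//; apply: subE.
      by apply: measurable_sqnormcB => //; exact: mL2.
    by move=> p; rewrite sqnormc_ge0/= -addrA lerDl addr_ge0 ?sqnormc_ge0.
  - under [X in (_ <= X + _)%E]eq_integral do rewrite mul1r.
    exact: strip_poincare.
  - have h1 : 0 <= (1 : R) <= 1 by rewrite ler01 lexx.
    apply: (le_trans (strip_young eta0 h1 crho hrho (mwy n) (mL2 _ Lgy))).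
    rewrite leeD2l// lee_wpmul2l ?lee_fin//; apply: subE.
      by apply: measurable_sqnormcB => //; exact: mL2.
    by move=> p; rewrite sqnormc_ge0/= -[X in X <= _]sqnormcN opprB lerDr addr_ge0 ?sqnormc_ge0.
(* The error terms tend to 0 while [U] and [G] are fixed. *)
have lim : (U <= ((1 + eta) ^+ 2)%:E * G)%E.
  have c0 : (((1 + eta) ^+ 2)%:E * G +
      (((1 + eta) * C1 + C1)%:E * E n + ((1 + eta) * C2)%:E * Dn n))%E @[n --> \oo] -->
      (((1 + eta) ^+ 2)%:E * G + 0)%E.
    apply: cvgeD; first by rewrite fin_num_adde_defl.
      exact: cvg_cst.
    rewrite -(adde0 0%E); apply: cvgeD => //.
      by rewrite -(mule0 ((1 + eta) * C1 + C1)%:E); exact: cvgeZl.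
    by rewrite -(mule0 ((1 + eta) * C2)%:E); exact: cvgeZl.
  rewrite -[X in (_ <= X)%E]adde0; apply: (cvge_ge _ c0); exact: nearW.
pose P := (\int[mu2]_(p in S) (rho p.1 * sqnormc (u p))%:E)%E.
have mP : measurable_fun (S : set T2) (fun p => (rho p.1 * sqnormc (u p))%:E).
  apply/measurable_EFinP; apply: measurable_funM.
    apply: measurable_funTS; apply: (@measurableT_comp _ _ _ _ _ _ rho) => //.
    exact: continuous_measurable_fun.
  by apply/measurable_EFinP; have [? ?] := mL2 _ Lu; exact: measurable_sqnormc.
have PZ c : 0 <= c -> (\int[mu2]_(p in S) (c * (rho p.1 * sqnormc (u p)))%:E = c%:E * P)%E.
  move=> c0; under eq_integral do rewrite EFinM; rewrite ge0_integralZl//.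
  by move=> p _; rewrite lee_fin mulr_ge0 ?sqnormc_ge0.
have UE : U = ((k ^+ 2)%:E * P)%E.
  rewrite -PZ ?sqr_ge0//; apply: eq_integral => p _; congr EFin; ring.
rewrite PZ ?sqr_ge0//.
have GE : G = (\int[mu2]_(p in S) (rho p.1 * sqnormc (gy p))%:E)%E.
  by apply: eq_integral => p _; rewrite mul1r.
rewrite -GE; have e2 : 0 < (1 + eta) ^+ 2 by rewrite exprn_gt0//; lra.
rewrite -(@lee_pmul2l _ ((1 + eta) ^+ 2)%:E)// ?lte_fin//; apply: le_trans lim.
rewrite UE muleA -EFinM lee_wpmul2r//.
  by apply: integral_ge0 => p _; rewrite lee_fin mulr_ge0 ?sqnormc_ge0.
rewrite lee_fin -exprMn lerXn2r ?nnegrE /eta /k; nra.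
Qed.

End form_poincare.

(** * The weighted energy estimate *)

Section energy.
Variable R : realType.
Local Notation T2 := (measurableTypeR R * measurableTypeR R)%type.
Local Notation mu2 := (@lebesgue_measure R \x @lebesgue_measure R)%E.
Local Notation Re := complex.Re.
Local Notation Im := complex.Im.
Local Notation S := (@strip R).
Implicit Types (D : set (R * R)) (u v g gx gy w : R * R -> R[i]) (h : R * R -> R).

Definition dot (z w : R[i]) : R := Re z * Re w + Im z * Im w.

Lemma dot_gradM e h u g p :
  dot (g p) (gradM e h u g p) = h p * sqnormc (g p) + 'D_e h p * dot (g p) (u p).
Proof. by rewrite /dot Re_gradM Im_gradM sqnormcE; ring. Qed.

Lemma ReD (z w : R[i]) : Re (z + w) = Re z + Re w.
Proof. by case: z w => [? ?] []. Qed.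

Lemma Re_dotL2 D u v : Re (dotL2 D u v) = \int[mu2]_(p in D) dot (u p) (v p).
Proof. by rewrite /dotL2 /integralC/=; apply: eq_Rintegral => p _; rewrite Re_dot. Qed.

(** The real part of the eigenvalue equation tested against [h * u]. *)
Lemma energy_identity (theta lambda M : R) h u gx gy : bounded_C1 h M ->
  mix_form_domain theta u gx gy ->
  (forall v hx hy, mix_form_domain theta v hx hy ->
     dotL2 (Omega theta) gx hx + dotL2 (Omega theta) gy hy =
     dotL2 (Omega theta) (fun p => lambda%:C%C * u p) v) ->
  \int[mu2]_(p in Omega theta) (h p * sqnormc (gx p) + 'D_(ex R) h p * dot (gx p) (u p)) +
  \int[mu2]_(p in Omega theta) (h p * sqnormc (gy p) + 'D_(ey R) h p * dot (gy p) (u p)) =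
  \int[mu2]_(p in Omega theta) (lambda * (h p * sqnormc (u p))).
Proof.
move=> hM fu form; have eqn := form _ _ _ (mix_form_domainM hM fu).
set O := Omega theta in eqn *.
have E1 : Re (dotL2 O gx (gradM (ex R) h u gx) + dotL2 O gy (gradM (ey R) h u gy)) =
    \int[mu2]_(p in O) dot (gx p) (gradM (ex R) h u gx p) +
    \int[mu2]_(p in O) dot (gy p) (gradM (ey R) h u gy p).
  by rewrite ReD; congr (_ + _); exact: Re_dotL2.
have E2 := Re_dotL2 O (fun p => lambda%:C%C * u p) (fun p => (h p)%:C%C * u p).
have {E1 E2 eqn} := etrans (esym E1) (etrans (congr1 (@complex.Re R) eqn) E2).
under eq_Rintegral do rewrite dot_gradM.
under [X in _ + X]eq_Rintegral do rewrite dot_gradM.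
move=> ->; apply: eq_Rintegral => p _.
rewrite /dot !Re_mull_real !Im_mull_real sqnormcE; ring.
Qed.

(** The square of the weight as a function on the plane: the multiplier against which the
    eigenvalue equation is tested. *)
Definition sqweight (b d : R) (p : R * R) : R := weight b d p.1 ^+ 2.

Lemma derive_sqweight (b d : R) (e p : R * R) : 0 < d ->
  'D_e (sqweight b d) p = e.1 * (2 * b * weight b d p.1 ^+ 2 * (1 - d * weight b d p.1)).
Proof.
move=> d0; have h := is_derive_weight_fst b p e d0.
have [_ ->] := is_deriveM h h.
by rewrite /GRing.scale/=; ring.
Qed.

Lemma weight_sqr_le (b d x : R) : 0 < d -> weight b d x ^+ 2 <= d^-1 ^+ 2.
Proof.
move=> d0; have w0 := ltW (weight_gt0 b x d0); have d1 : 0 <= d^-1 by rewrite invr_ge0 ltW.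
rewrite lerXn2r ?nnegrE//.
by rewrite -[leRHS]mul1r ler_pdivlMr// mulrC weight_le.
Qed.

Lemma sqweight_bounded (b d : R) : 0 < b -> 0 < d ->
  exists M, bounded_C1 (sqweight b d) M.
Proof.
move=> b0 d0.
have w0 (p : R * R) : 0 < weight b d p.1 by exact: weight_gt0.
have w1 (p : R * R) : weight b d p.1 ^+ 2 <= d^-1 ^+ 2 by exact: weight_sqr_le.
have wd (p : R * R) : 0 <= 1 - d * weight b d p.1 <= 1.
  have := weight_le b p.1 d0; have := mulr_gt0 d0 (w0 p); lra.
have N0 : 0 <= d^-1 ^+ 2 by rewrite sqr_ge0.
exists (d^-1 ^+ 2 + 2 * b * d^-1 ^+ 2); split.
- by move=> n; apply: CkM; exact: Ck_weight.
- move=> p; rewrite ger0_norm ?sqr_ge0// (le_trans (w1 p))// lerDl; nra.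
- move=> p; rewrite derive_sqweight//= mul1r.
  have := wd p; have := w1 p; have := sqr_ge0 (weight b d p.1).
  move: (weight b d p.1 ^+ 2) (1 - _) (d^-1 ^+ 2) N0 => W r N N0 W0 WN /andP[r0 r1].
  rewrite ger0_norm; last by rewrite mulr_ge0// mulr_ge0// mulr_ge0// ltW.
  apply: (@le_trans _ _ (2 * b * W)); first by rewrite ler_piMr// mulr_ge0// mulr_ge0// ltW.
  by rewrite (@le_trans _ _ (2 * b * N))// ?ler_wpM2l ?mulr_ge0 ?(ltW b0)// lerDr.
- by move=> p; rewrite derive_sqweight//= mul0r normr0 addr_ge0// mulr_ge0// mulr_ge0// ltW.
Qed.

Lemma le_Rintegral_subset (D E : set T2) (f : T2 -> R) : measurable D -> measurable E ->
  D `<=` E -> (forall p, 0 <= f p) -> mu2.-integrable E (fun p => (f p)%:E) ->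
  \int[mu2]_(p in D) f p <= \int[mu2]_(p in E) f p.
Proof.
move=> mD mE DE f0 fi; have fiD := integrableS mE mD DE fi.
rewrite /Rintegral fine_le ?integrable_fin_num//.
apply: ge0_subset_integral => //; first exact: measurable_int fi.
by move=> p _; rewrite lee_fin.
Qed.

Lemma sqnormcD_dot (r : R) (z w : R[i]) :
  sqnormc (z + r%:C%C * w) = sqnormc z + 2 * r * dot z w + r ^+ 2 * sqnormc w.
Proof.
by rewrite !sqnormcE /dot !raddfD/= !Re_mull_real !Im_mull_real; ring.
Qed.

(** The arithmetic end of [agmon_bound]. Here [JP] and [JB] are the weighted integrals over
    the strip of the squares of the function and of its vertical derivative, [JE] that of the
    horizontal part of the energy, and [IE] and [IB] are integrals over the whole domain. The
    Poincare inequality [s2 * JP <= JB] and the energy identity bound [JP] as soon as [a < s2]. *)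
Lemma agmon_arith (s2 a b2 N JP JB JE IB IE : R) :
  let M1 := N / (s2 - a) in let M2 := `|a| * M1 + N in
  a < s2 -> 0 <= b2 -> 0 <= JP -> 0 <= JB -> 0 <= IE -> s2 * JP <= JB -> JB <= IB -> JE <= IE ->
  IE + IB <= a * JP + N ->
  JP + (2 * JE + 2 * b2 * JP + JB) <= M1 + (2 * M2 + 2 * b2 * M1 + M2).
Proof.
move=> M1 M2 as2 b20 JP0 JB0 IE0 poinc BJ EJ total.
have JPM1 : JP <= M1 by rewrite /M1 ler_pdivlMr ?subr_gt0//; lra.
have sumM2 : IE + IB <= M2.
  rewrite (le_trans total)// /M2 lerD2r (le_trans (ler_norm _))// normrM (ger0_norm JP0).
  by rewrite ler_wpM2l.
have h1 : b2 * JP <= b2 * M1 by rewrite ler_wpM2l.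
rewrite -!mulrA; move: (b2 * JP) (b2 * M1) h1 => x y h1; lra.
Qed.

(** The Agmon estimate. Write [w] for the weight, [W = w ^+ 2] and [V = (w') ^+ 2]. The energy
    identity with multiplier [W], after completing the square in [w * gx + w' * u], reads
    [\int (|w * gx + w' * u|^2 + W * |gy|^2) = \int (lambda * W + V) * |u|^2]. On the strip
    [V <= b ^+ 2 * W], and to its left [W <= 1] and [V <= b ^+ 2]; the Poincare inequality with a
    constant larger than [lambda + b ^+ 2] absorbs the contribution of the strip in the left-hand
    side. The bound does not depend on [d] because the weights stay below 1 on the left. *)
Lemma agmon_bound (theta lambda b : R) u gx gy : 0 < theta < pi / 2 -> 0 < b ->
  lambda + b ^+ 2 < 1 -> mix_form_domain theta u gx gy ->
  (forall v hx hy, mix_form_domain theta v hx hy ->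
     dotL2 (Omega theta) gx hx + dotL2 (Omega theta) gy hy =
     dotL2 (Omega theta) (fun p => lambda%:C%C * u p) v) ->
  exists C, forall d, 0 < d ->
    (\int[mu2]_(p in S) (sqweight b d p *
       (sqnormc (u p) + (sqnormc (gx p) + sqnormc (gy p))))%:E <= C%:E)%E.
Proof.
move=> ht b0 lb fu form; set O := Omega theta.
have mO : measurable (O : set T2) by exact: measurable_Omega.
have mS : measurable (S : set T2) by exact: measurable_strip.
have SO := strip_Omega ht.
have [[Lu Lgx Lgy _ _] _] := fu.
have iP := L2_integrable mO Lu; have iA := L2_integrable mO Lgx; have iB := L2_integrable mO Lgy.
have iX : mu2.-integrable O (fun p => (dot (gx p) (u p))%:E).
  move: Lu Lgx => /(L2P _ mO)[ur ui] /(L2P _ mO)[gr gi].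
  apply: (eq_integrable mO (fun p => (Re (gx p) * Re (u p))%:E + (Im (gx p) * Im (u p))%:E)%E).
    by move=> p _; rewrite -EFinD.
  by apply: integrableD => //; exact: sqint_integrableM.
(* [lambda] may be negative, so [s ^+ 2] is compared with a nonnegative upper bound of
   [lambda + b ^+ 2]. *)
pose t := Num.max 0 (lambda + b ^+ 2); pose s := (1 + t) / 2.
have t0 : 0 <= t by rewrite le_max lexx.
have t1 : t < 1 by rewrite gt_max ltr01.
have tl : lambda + b ^+ 2 <= t by rewrite le_max lexx orbT.
have s01 : 0 < s < 1 by rewrite /s; apply/andP; split; lra.
have st : t < s ^+ 2 by rewrite /s; nra.
have as2 : lambda + b ^+ 2 < s ^+ 2 by exact: le_lt_trans st.
pose N := (`|lambda| + b ^+ 2) * \int[mu2]_(p in O) sqnormc (u p).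
pose M1 := N / (s ^+ 2 - (lambda + b ^+ 2)); pose M2 := `|lambda + b ^+ 2| * M1 + N.
exists (M1 + (2 * M2 + 2 * b ^+ 2 * M1 + M2)) => d d0.
have [M hM] := sqweight_bounded b0 d0; have eqn := energy_identity hM fu form.
have [sW bW bWx bWy] := hM.
pose W := sqweight b d; pose V (p : R * R) := b ^+ 2 * (W p * (1 - d * weight b d p.1) ^+ 2).
have W0 p : 0 <= W p by exact: sqr_ge0.
have wd (p : R * R) : 0 <= 1 - d * weight b d p.1 <= 1.
  have := weight_le b p.1 d0; have := mulr_gt0 d0 (weight_gt0 b p.1 d0); lra.
have VW p : 0 <= V p <= b ^+ 2 * W p.
  have /andP[r0 r1] := wd p; rewrite /V; apply/andP; split.
    by rewrite mulr_ge0 ?sqr_ge0// mulr_ge0// sqr_ge0.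
  rewrite ler_wpM2l ?sqr_ge0// ler_piMr//; nra.
have mW : measurable_fun (O : set T2) W.
  by apply: continuous_measurable2 => //; exact: smooth_continuous.
have mWx : measurable_fun (O : set T2) (fun p => 'D_(ex R) W p).
  by apply: continuous_measurable2 => //; apply: smooth_continuous; apply: smooth_derive => //; left.
have mV : measurable_fun (O : set T2) V.
  apply: measurable_funM => //; apply: measurable_funM => //; apply: measurable_funX.
  apply: measurable_funB => //; apply: measurable_funM => //.
  apply: continuous_measurable2 => //; apply: (@smooth_continuous _ (fun p => weight b d p.1)).
  by move=> n; exact: Ck_weight.
have iW f : mu2.-integrable O (fun p => (f p)%:E) -> mu2.-integrable O (fun p => (W p * f p)%:E).
  by apply: (integrable_bddM mO mW (M := M)) => p _; exact: bW.
have iWx f : mu2.-integrable O (fun p => (f p)%:E) ->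
    mu2.-integrable O (fun p => ('D_(ex R) W p * f p)%:E).
  by apply: (integrable_bddM mO mWx (M := M)) => p _; exact: bWx.
have iV f : mu2.-integrable O (fun p => (f p)%:E) -> mu2.-integrable O (fun p => (V p * f p)%:E).
  apply: (integrable_bddM mO mV (M := b ^+ 2 * M)) => p _.
  have /andP[v0 v1] := VW p; rewrite ger0_norm// (le_trans v1)// ler_wpM2l ?sqr_ge0//.
  by rewrite (le_trans (ler_norm _))//; exact: bW.
have iWP := iW _ iP; have iWA := iW _ iA; have iWB := iW _ iB; have iWX := iWx _ iX; have iVP := iV _ iP.
pose E1 p := W p * sqnormc (gx p) + 'D_(ex R) W p * dot (gx p) (u p) + V p * sqnormc (u p).
have iWAX : mu2.-integrable O (fun p => (W p * sqnormc (gx p) + 'D_(ex R) W p * dot (gx p) (u p))%:E).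
  exact: (integrableD mO iWA iWX).
have iE1 : mu2.-integrable O (fun p => (E1 p)%:E) by exact: (integrableD mO iWAX iVP).
(* For [r = 1] this writes [E1] as the square of the completed term; for [r = 2] it bounds
   the square of [w * gx] by that term and by the square of [w' * u]. *)
have E1E r p : W p * sqnormc (gx p) + r * 'D_(ex R) W p * dot (gx p) (u p) +
    r ^+ 2 * (V p * sqnormc (u p)) =
    W p * sqnormc (gx p + (r * b * (1 - d * weight b d p.1))%:C%C * u p).
  by rewrite sqnormcD_dot derive_sqweight// /V /W /sqweight/=; ring.
have E10 p : 0 <= E1 p.
  by have := E1E 1 p; rewrite expr1n !mul1r -/(E1 p) => ->; rewrite mulr_ge0// sqnormc_ge0.
have AE p : W p * sqnormc (gx p) <= 2 * E1 p + 2 * (V p * sqnormc (u p)).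
  have : 0 <= W p * sqnormc (gx p) + 2 * 'D_(ex R) W p * dot (gx p) (u p) +
      2 ^+ 2 * (V p * sqnormc (u p)).
    by rewrite E1E mulr_ge0// sqnormc_ge0.
  move=> h; rewrite -subr_ge0; apply: le_trans h _; rewrite le_eqVlt; apply/orP; left; apply/eqP.
  by rewrite /E1; ring.
have total : \int[mu2]_(p in O) E1 p + \int[mu2]_(p in O) (W p * sqnormc (gy p)) =
    \int[mu2]_(p in O) (lambda * (W p * sqnormc (u p)) + V p * sqnormc (u p)).
  have t1' : \int[mu2]_(p in O) E1 p =
      \int[mu2]_(p in O) (W p * sqnormc (gx p) + 'D_(ex R) W p * dot (gx p) (u p)) +
      \int[mu2]_(p in O) (V p * sqnormc (u p)) := RintegralD mO iWAX iVP.
  have t2' : \int[mu2]_(p in O) (lambda * (W p * sqnormc (u p)) + V p * sqnormc (u p)) =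
      \int[mu2]_(p in O) (lambda * (W p * sqnormc (u p))) +
      \int[mu2]_(p in O) (V p * sqnormc (u p)) := RintegralD mO (integrableZl mO lambda iWP) iVP.
  have yE : \int[mu2]_(p in O) (W p * sqnormc (gy p)) =
      \int[mu2]_(p in O) (W p * sqnormc (gy p) + 'D_(ey R) W p * dot (gy p) (u p)).
    by apply: eq_Rintegral => p _; rewrite derive_sqweight//= !mul0r addr0.
  by rewrite t1' yE addrAC t2'; congr (_ + _); exact: eqn.
have J_le f : (forall p, 0 <= f p) -> mu2.-integrable O (fun p => (f p)%:E) ->
    \int[mu2]_(p in S) f p <= \int[mu2]_(p in O) f p.
  by move=> f0 fi; exact: (le_Rintegral_subset mS mO SO f0 fi).
have iS f : mu2.-integrable O (fun p => (f p)%:E) -> mu2.-integrable S (fun p => (f p)%:E).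
  exact: (integrableS mO mS SO).
have WP0 p : 0 <= W p * sqnormc (u p) by rewrite mulr_ge0// sqnormc_ge0.
have WB0 p : 0 <= W p * sqnormc (gy p) by rewrite mulr_ge0// sqnormc_ge0.
pose JP := \int[mu2]_(p in S) (W p * sqnormc (u p)).
have JP0 : 0 <= JP by apply: Rintegral_ge0 => p _.
have poinc : s ^+ 2 * JP <= \int[mu2]_(p in S) (W p * sqnormc (gy p)).
  rewrite /JP -RintegralZl//; last exact: iS.
  rewrite /Rintegral fine_le ?integrable_fin_num//.
  - exact: (integrableZl mS (s ^+ 2) (iS _ iWP)).
  - exact: iS.
  apply: (form_strip_poincare (M := d^-1 ^+ 2) (rho := fun x => weight b d x ^+ 2) ht s01 _ _ fu).
    by move=> x; apply: cvgM; exact: weight_continuous.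
  by move=> x; rewrite sqr_ge0 weight_sqr_le.
(* The strip contributes the term to be absorbed, the rest of the domain a constant. *)
have upper : \int[mu2]_(p in O) (lambda * (W p * sqnormc (u p)) + V p * sqnormc (u p)) <=
    (lambda + b ^+ 2) * JP + N.
  have mT : measurable (O `\` S : set T2) by exact: measurableD.
  have iF : mu2.-integrable O (fun p => (lambda * (W p * sqnormc (u p)) + V p * sqnormc (u p))%:E).
    exact: (integrableD mO (integrableZl mO lambda iWP) iVP).
  have iT f : mu2.-integrable O (fun p => (f p)%:E) -> mu2.-integrable (O `\` S) (fun p => (f p)%:E).
    by apply: integrableS => //; exact: subDsetl.
  have OE : O = S `|` (O `\` S) by rewrite setDUK.
  rewrite {1}OE Rintegral_setU//; last 2 first.
  - by rewrite -OE.
  - by rewrite disj_set2E setDIK.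
  apply: lerD.
    rewrite /JP -RintegralZl//; last exact: iS.
    apply: le_Rintegral => //.
    - exact: iS.
    - exact: (integrableZl mS _ (iS _ iWP)).
    move=> p _; rewrite [leRHS]mulrDl lerD2l mulrA ler_wpM2r ?sqnormc_ge0//.
    by have /andP[] := VW p.
  have P0 : 0 <= `|lambda| + b ^+ 2 by rewrite addr_ge0// sqr_ge0.
  apply: (@le_trans _ _ ((`|lambda| + b ^+ 2) * \int[mu2]_(p in O `\` S) sqnormc (u p))); last first.
    have TO : O `\` S `<=` O by exact: subDsetl.
    by rewrite /N ler_wpM2l//; apply: (le_Rintegral_subset mT mO TO _ iP) => p; exact: sqnormc_ge0.
  rewrite -RintegralZl//; last exact: iT.
  apply: le_Rintegral => //.
  - exact: iT.
  - exact: (integrableZl mT _ (iT _ iP)).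
  move=> p [[h1 h2 h3 h4] nS]; rewrite mulrA -mulrDl ler_wpM2r ?sqnormc_ge0//.
  have p0 : p.1 <= 0 by rewrite leNgt; apply/negP => p0; apply: nS.
  have W1 : W p <= 1 by rewrite /W /sqweight expr_le1// ?weight_le1// ltW// weight_gt0.
  have /andP[_ VW1] := VW p; rewrite lerD//.
    by rewrite (le_trans (ler_norm _))// normrM (ger0_norm (W0 p)) ler_piMr.
  by rewrite (le_trans VW1)// ler_piMr// sqr_ge0.
have E1J := J_le _ E10 iE1; have BJ := J_le _ WB0 iWB.
have IE0 : 0 <= \int[mu2]_(p in O) E1 p by apply: Rintegral_ge0 => p _.
pose JB := \int[mu2]_(p in S) (W p * sqnormc (gy p)); pose JE := \int[mu2]_(p in S) E1 p.
have VP0 p : 0 <= V p * sqnormc (u p) by rewrite mulr_ge0 ?sqnormc_ge0//; case/andP: (VW p).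
have iall : mu2.-integrable S (fun p => (W p * (sqnormc (u p) + (sqnormc (gx p) + sqnormc (gy p))))%:E).
  by apply: iS; apply: iW; exact: (integrableD mO iP (integrableD mO iA iB)).
have -> : (\int[mu2]_(p in S) (W p * (sqnormc (u p) + (sqnormc (gx p) + sqnormc (gy p))))%:E =
    (\int[mu2]_(p in S) (W p * (sqnormc (u p) + (sqnormc (gx p) + sqnormc (gy p)))))%R%:E)%E.
  by rewrite /Rintegral fineK// integrable_fin_num.
rewrite lee_fin.
(* A majorant of the weighted square of [gx], by [AE] and [VW]. *)
pose F2 p := 2 * E1 p + 2 * b ^+ 2 * (W p * sqnormc (u p)).
have iF2 : mu2.-integrable S (fun p => (F2 p)%:E).
  exact: (integrableD mS (integrableZl mS 2 (iS _ iE1)) (integrableZl mS (2 * b ^+ 2) (iS _ iWP))).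
have iF3 : mu2.-integrable S (fun p => (F2 p + W p * sqnormc (gy p))%:E).
  exact: (integrableD mS iF2 (iS _ iWB)).
have F2E : \int[mu2]_(p in S) F2 p = 2 * JE + 2 * b ^+ 2 * JP.
  rewrite RintegralD//.
  - by rewrite !RintegralZl//; exact: iS.
  - exact: (integrableZl mS 2 (iS _ iE1)).
  - exact: (integrableZl mS (2 * b ^+ 2) (iS _ iWP)).
have F3E : \int[mu2]_(p in S) (F2 p + W p * sqnormc (gy p)) = 2 * JE + 2 * b ^+ 2 * JP + JB.
  by rewrite RintegralD//; [rewrite F2E|exact: iS].
have F4E : \int[mu2]_(p in S) (W p * sqnormc (u p) + (F2 p + W p * sqnormc (gy p))) =
    JP + (2 * JE + 2 * b ^+ 2 * JP + JB).
  by rewrite RintegralD//; [rewrite F3E|exact: iS].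
apply: (@le_trans _ _ (JP + (2 * JE + 2 * b ^+ 2 * JP + JB))).
  rewrite -F4E; apply: le_Rintegral => //.
    exact: (integrableD mS (iS _ iWP) iF3).
  move=> p _; rewrite !mulrDr lerD2l lerD2r /F2 (le_trans (AE p))// lerD2l -mulrA ler_wpM2l//.
  by rewrite mulrA ler_wpM2r ?sqnormc_ge0//; case/andP: (VW p).
have JB0 : 0 <= JB by apply: Rintegral_ge0 => p _.
by apply: (agmon_arith as2 (sqr_ge0 b) JP0 JB0 IE0 poinc BJ E1J); rewrite total.
Qed.
End energy.

(** * Uniqueness of weak derivatives *)

Section bump.
Variable R : realType.
Local Notation T1 := (measurableTypeR R).
Local Notation T2 := (measurableTypeR R * measurableTypeR R)%type.
Local Notation mu2 := (@lebesgue_measure R \x @lebesgue_measure R)%E.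
Local Notation S := (@strip R).
Implicit Types (D : set (R * R)) (f g h phi : R * R -> R).

Definition rect (a b c d : R) : set (R * R) :=
  [set p | [/\ a < p.1, p.1 < b, c < p.2 & p.2 < d]].

Lemma measurable_rect a b c d : measurable (rect a b c d : set T2).
Proof.
have -> : rect a b c d = ([set` `]a, b[%R] : set R) `*` ([set` `]c, d[%R] : set R).
  apply/seteqP; split=> [p [h1 h2 h3 h4]|p [/=]].
    by split; rewrite /= in_itv/= ?h1 ?h2 ?h3.
  by rewrite !in_itv/= => /andP[? ?] /andP[? ?].
by apply: measurableX; exact: measurable_itv.
Qed.

Lemma flat_le1 (x : R) : flat 0 x <= 1.
Proof.
rewrite /flat; case: ifPn => // x0.
by rewrite expr0 invr1 mul1r -expR0 ler_expR oppr_le0 invr_ge0 ltW.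
Qed.

(** A smooth function that vanishes on a neighbourhood of the negative half-line and tends to
    the indicator of the positive half-line as [n] grows. *)
Definition ramp (n : nat) (t : R) : R := flat 0 (n.+1%:R * t + -1).

Lemma ramp_ge0 n t : 0 <= ramp n t. Proof. exact: flat_ge0. Qed.

Lemma ramp_le1 n t : ramp n t <= 1. Proof. exact: flat_le1. Qed.

Lemma ramp_eq0 n t : t <= n.+1%:R^-1 -> ramp n t = 0.
Proof.
move=> tn; rewrite /ramp /flat ifF//; apply/negbTE; rewrite -leNgt.
by rewrite subr_le0 -ler_pdivlMl ?ltr0n// mulr1.
Qed.

Lemma ramp_cvg t : 0 < t -> ramp n t @[n --> \oo] --> (1 : R).
Proof.
move=> t0; apply/cvgrPdist_le => e e0; near=> n.
rewrite ger0_norm ?subr_ge0 ?ramp_le1//.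
have s1 : e^-1 <= n.+1%:R * t + -1.
  rewrite -lerBlDr opprK -ler_pdivrMr// (@le_trans _ _ n%:R) ?ler_nat//.
  by near: n; exact: nbhs_infty_ger.
have s0 : 0 < n.+1%:R * t + -1 by apply: lt_le_trans s1; rewrite invr_gt0.
rewrite /ramp /flat s0 expr0 invr1 mul1r.
have := expR_ge1Dx (- (n.+1%:R * t + -1)^-1).
have : (n.+1%:R * t + -1)^-1 <= e by rewrite invf_ple.
move: (_ ^-1) (expR _) => x y; lra.
Unshelve. all: by end_near. Qed.

(** Test functions supported inside an open rectangle and converging to its indicator. *)
Definition bump (a b c d : R) (n : nat) (p : R * R) : R :=
  ramp n (p.1 - a) * ramp n (b - p.1) * (ramp n (p.2 - c) * ramp n (d - p.2)).

Lemma bump_smooth a b c d n : smooth (bump a b c d n).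
Proof.
move=> k; pose N : R := n.+1%:R.
have -> : bump a b c d n = (fun p => flat 0 (N * p.1 + 0 * p.2 + (- (N * a) - 1)) *
    flat 0 ((- N) * p.1 + 0 * p.2 + (N * b - 1)) *
    (flat 0 (0 * p.1 + N * p.2 + (- (N * c) - 1)) * flat 0 (0 * p.1 + (- N) * p.2 + (N * d - 1)))).
  apply/funext => p; rewrite /bump /ramp -/N; congr (flat 0 _ * flat 0 _ * (flat 0 _ * flat 0 _)); ring.
by apply: CkM; apply: CkM; exact: Ck_flat.
Qed.

Lemma bump_ge0 a b c d n p : 0 <= bump a b c d n p.
Proof. by rewrite !mulr_ge0 ?ramp_ge0. Qed.

Lemma bump_le1 a b c d n p : bump a b c d n p <= 1.
Proof.
by rewrite mulr_ile1 ?mulr_ge0 ?mulr_ile1 ?ramp_ge0 ?ramp_le1.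
Qed.

Lemma bump_support a b c d n : closure [set p | bump a b c d n p != 0] `<=`
  ([set` `[a + n.+1%:R^-1, b - n.+1%:R^-1]%R] : set R) `*`
  ([set` `[c + n.+1%:R^-1, d - n.+1%:R^-1]%R] : set R).
Proof.
set K := _ `*` _; have cK : compact K by apply: compact_setX; exact: segment_compact.
have : closed K by exact: compact_closed.
move=> /closure_id ->; apply: closure_subset => p /=; rewrite /bump.
rewrite !mulf_eq0 !negb_or => /andP[/andP[h1 h2] /andP[h3 h4]].
have pos t : ramp n t != 0 -> n.+1%:R^-1 <= t.
  by apply: contra_neqT; rewrite -ltNge => /ltW /ramp_eq0.
move: (pos _ h1) (pos _ h2) (pos _ h3) (pos _ h4); rewrite /K; move: (n.+1%:R^-1) => x *.
by split; rewrite /= in_itv/=; apply/andP; split; lra.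
Qed.

Lemma bump_test_fun D a b c d n : rect a b c d `<=` D -> test_fun D (bump a b c d n).
Proof.
move=> rD; split; first exact: bump_smooth.
- apply: (subclosed_compact _ _ (bump_support (a := a) (b := b) (c := c) (d := d) (n := n))).
    exact: closed_closure.
  by apply: compact_setX; exact: segment_compact.
- apply: subset_trans (bump_support (n := n)) _; apply: subset_trans rD => p [/=].
  have n0 : 0 < n.+1%:R^-1 :> R by rewrite invr_gt0 ltr0n.
  rewrite !in_itv/=; move: (n.+1%:R^-1) n0 => x x0 /andP[h1 h2] /andP[h3 h4].
  by split; lra.
Qed.

Lemma bump_out a b c d n p : ~ rect a b c d p -> bump a b c d n p = 0.
Proof.
move=> np; apply/eqP; apply: contra_notT np => b0.
have [_ _] := bump_test_fun n (@subset_refl _ (rect a b c d)); apply.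
exact: subset_closure.
Qed.

Lemma bump_cvg a b c d p : bump a b c d n p @[n --> \oo] --> (\1_(rect a b c d) p : R).
Proof.
rewrite indicE; have [|] := boolP (p \in rect a b c d).
  rewrite inE => -[h1 h2 h3 h4].
  rewrite [X in _ --> X](_ : _ = 1 * 1 * (1 * 1 : R)); last by rewrite !mulr1.
  by apply: cvgM; apply: cvgM; apply: ramp_cvg; rewrite subr_gt0.
rewrite notin_setE => np; rewrite (_ : (fun n => _) = fun=> 0); first exact: cvg_cst.
by apply/funext => n; rewrite bump_out.
Qed.

Lemma rect_indic_sqint D a b c d : measurable (D : set T2) ->
  sqint mu2 D (\1_(rect a b c d) : R * R -> R).
Proof.
move=> mD; set Q := rect a b c d; have mQ : measurable (Q : set T2) by exact: measurable_rect.
apply: sqintP => //.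
apply: (@le_lt_trans _ _ (mu2 (([set` `[a, b]%R] : set R) `*` ([set` `[c, d]%R] : set R)))).
  rewrite (_ : (\int[mu2]_(p in D) (\1_Q p ^+ 2)%:E = \int[mu2]_(p in D) (\1_Q p)%:E)%E).
    rewrite integral_indic//; apply: le_measure; rewrite ?inE.
    - exact: measurableI.
    - by apply: measurableX; exact: measurable_itv.
    - move=> p [[h1 h2 h3 h4] _].
      by split; rewrite /= in_itv/=; apply/andP; split; exact: ltW.
  by apply: eq_integral => p _; rewrite indicE; case: (_ \in _); rewrite ?expr1n ?expr0n.
apply: compact_finite_measure2; apply: compact_setX; exact: segment_compact.
Qed.

(** Dominated convergence along the functions [bump], dominated by [|h|] times the
    indicator of the rectangle. *)
Lemma rect_integral0 D h a b c d : measurable (D : set T2) -> sqint mu2 D h ->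
  (forall phi, test_fun D phi -> \int[mu2]_(p in D) (h p * phi p) = 0) ->
  rect a b c d `<=` D -> (\int[mu2]_(p in rect a b c d) (h p)%:E = 0)%E.
Proof.
move=> mD sh h0 rD; set Q := rect a b c d.
have mQ : measurable (Q : set T2) by exact: measurable_rect.
have s1 := rect_indic_sqint a b c d mD.
have ib n : mu2.-integrable D (fun p => (h p * bump a b c d n p)%:E).
  by apply: sqint_integrableM => //; apply: test_fun_sqint (bump_test_fun n rD).
have i1 := sqint_integrableM mD sh s1.
have ia : mu2.-integrable D (fun p => `|(h p * \1_Q p)%:E|%E) by exact: integrable_abse.
have acvg : {ae mu2, forall p, D p -> (h p * bump a b c d n p)%:E @[n --> \oo] --> (h p * \1_Q p)%:E}.
  apply: aeW => p _; apply/cvg_EFin; first exact: nearW.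
  by apply: cvgM; [exact: cvg_cst|exact: bump_cvg].
have adom : {ae mu2, forall p n, D p -> (`|(h p * bump a b c d n p)%:E| <= `|(h p * \1_Q p)%:E|)%E}.
  apply: aeW => p n _; rewrite !abse_EFin lee_fin [leLHS]normrM [leRHS]normrM ler_wpM2l//.
  rewrite ger0_norm ?bump_ge0// indicE.
  have [Qp|] := boolP (p \in Q); first by rewrite normr1 bump_le1.
  by rewrite notin_setE => nQ; rewrite bump_out// normr0.
have [_ _] := dominated_convergence mD (fun n => measurable_int _ (ib n))
  (measurable_int _ i1) acvg ia adom.
have -> : (fun n => \int[mu2]_(p in D) (h p * bump a b c d n p)%:E)%E = fun=> 0%E.
  apply/funext => n; have := h0 _ (bump_test_fun n rD); rewrite /Rintegral => {}h0.
  by rewrite -[LHS]fineK ?h0// integrable_fin_num.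
move=> /(cvg_unique _ (cvg_cst _)) => /(_ (@ereal_hausdorff R)) e.
rewrite (_ : Q = D `&` Q); last by rewrite setIC; apply/esym/setIidl.
rewrite integral_mkcondr [RHS]e; apply: eq_integral => p _.
by rewrite patchE indicE; case: (p \in Q); rewrite ?mulr1 ?mulr0.
Qed.

Definition quadrants : set (set T2) :=
  [set A | exists a c : R, A = [set p | a < p.1 /\ c < p.2]].

(** Quadrants form a pi-system generating the product sigma-algebra: in the
    sigma-algebra they generate both coordinates are measurable, since half-planes are countable
    unions of quadrants. *)
Lemma quadrants_generate : @measurable _ T2 = <<s quadrants >>.
Proof.
pose Tg := g_sigma_algebraType quadrants.
have quad a c : (@measurable _ Tg) [set p | a < p.1 /\ c < p.2].
  by apply: sub_sigma_algebra; exists a, c.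
have exn (x : R) : exists n : nat, - n%:R < x.
  exists (Num.bound `|x|); rewrite ltrNl (le_lt_trans (ler_norm _))// normrN.
  exact: archi_boundP.
have mfst : measurable_fun [set: Tg] (fst : Tg -> T1).
  apply: (measurability _ (RGenOInfty.measurableE R)) => _ [_ [x ->] <-]; rewrite setTI.
  rewrite (_ : _ @^-1` _ = \bigcup_n [set p | x < p.1 /\ - n%:R < p.2]).
    by apply: bigcupT_measurable => n; exact: quad.
  apply/seteqP; split=> [p|p [n _ [h _]]]; rewrite /= in_itv/= andbT => // h.
  by have [n hn] := exn p.2; exists n.
have msnd : measurable_fun [set: Tg] (snd : Tg -> T1).
  apply: (measurability _ (RGenOInfty.measurableE R)) => _ [_ [x ->] <-]; rewrite setTI.
  rewrite (_ : _ @^-1` _ = \bigcup_n [set p | - n%:R < p.1 /\ x < p.2]).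
    by apply: bigcupT_measurable => n; exact: quad.
  apply/seteqP; split=> [p|p [n _ [_ h]]]; rewrite /= in_itv/= andbT => // h.
  by have [n hn] := exn p.1; exists n.
(* The identity from the plane with the sigma-algebra of the quadrants to the plane with the
   product sigma-algebra. *)
have mid : measurable_fun [set: Tg] (fun p : Tg => ((fst p : T1), (snd p : T1)) : T2).
  exact: measurable_fun_pair.
apply/seteqP; split=> A mA.
  have := mid measurableT A mA; rewrite setTI.
  by rewrite (_ : _ @^-1` A = A)//; apply/seteqP; split=> -[].
move: A mA; apply: smallest_sub; first exact: sigma_algebra_measurable.
move=> A [a [c ->]].
rewrite (_ : [set p | _] = ([set` `]a, +oo[%R] : set T1) `*` ([set` `]c, +oo[%R] : set T1)).
  by apply: measurableX; exact: measurable_itv.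
by apply/seteqP; split=> p [h1 h2]; split; move: h1 h2; rewrite /= !in_itv/= !andbT.
Qed.

(** The du Bois-Reymond lemma. The integral of [h] vanishes on rectangles, hence by the
    pi-lambda theorem on all measurable subsets of each bounded piece [Q n] of the strip, so [h]
    vanishes almost everywhere there. On [Q n] the function is integrable, and
    the intersection of [Q n] with a quadrant is again a rectangle. *)
Lemma strip_orth_ae0 D h : measurable (D : set T2) -> S `<=` D -> sqint mu2 D h ->
  (forall phi, test_fun D phi -> \int[mu2]_(p in D) (h p * phi p) = 0) ->
  {ae mu2, forall p, S p -> h p = 0}.
Proof.
move=> mD SD sh h0; pose Q (n : nat) := rect 0 n%:R 0 pi.
have mQ n : measurable (Q n : set T2) by exact: measurable_rect.
have mT : measurable_fun (D : set T2) h by case: sh.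
have rS a b c d : 0 <= a -> 0 <= c -> d <= pi -> rect a b c d `<=` D.
  move=> a0 c0 dpi; apply: subset_trans SD => p [h1 h2 h3 h4].
  by split; [exact: le_lt_trans h1|exact: le_lt_trans h3|exact: lt_le_trans dpi].
have QD n : Q n `<=` D by exact: rS.
have iQ n : mu2.-integrable (Q n) (fun p => (h p)%:E).
  apply: (eq_integrable (mQ n) (fun p => (h p * \1_(Q n) p)%:E)).
    by move=> p pQ; rewrite indicE pQ mulr1.
  apply: (integrableS mD (mQ n) (QD n)).
  exact: (sqint_integrableM mD sh (rect_indic_sqint _ _ _ _ mD)).
suff H n : {ae mu2, forall p, Q n p -> h p = 0}.
  apply: filterS (ae_foralln H) => p hp Sp.
  have pn : Q (Num.bound p.1) p.
    by case: Sp => p1 p2 p3; split => //; apply: archi_boundP; exact: ltW.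
  exact: hp pn.
have P E : measurable (E : set T2) -> (\int[mu2]_(p in Q n `&` E) (h p)%:E = 0)%E.
  have iE F : measurable (F : set T2) -> mu2.-integrable (Q n `&` F) (fun p => (h p)%:E).
    by move=> mF; apply: (integrableS (mQ n) _ _ (iQ n)) => //; exact: measurableI.
  move=> mE; have : (<<s quadrants >>) E by rewrite -quadrants_generate.
  move: E {mE}; apply: (@dynkin_induction _ T2 quadrants
    (fun E => \int[mu2]_(p in Q n `&` E) (h p)%:E = 0)%E quadrants_generate).
  - move=> _ _ [a1 [c1 ->]] [a2 [c2 ->]]; exists (Num.max a1 a2), (Num.max c1 c2).
    by apply/seteqP; split=> p /=; rewrite !gt_max;
      [move=> [[-> ->] [-> ->]]|move=> [/andP[-> ->] /andP[-> ->]]].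
  - by rewrite setIT; apply: (rect_integral0 mD sh h0); exact: QD.
  - move=> _ [a [c ->]].
    rewrite (_ : _ `&` _ = rect (Num.max 0 a) n%:R (Num.max 0 c) pi).
      by apply: (rect_integral0 mD sh h0); apply: rS; rewrite // le_max lexx.
    by apply/seteqP; split=> p; [move=> [[h1 h2 h3 h4] [h5 h6]]|move=> [/=]];
      rewrite ?gt_max; [split; rewrite ?gt_max ?h1 ?h3|move=> /andP[? ?] ? /andP[? ?] ?; split].
  - move=> E mE PE.
    have := rect_integral0 mD sh h0 (QD n); rewrite -/(Q n).
    rewrite -[in X in X -> _](setIT (Q n)) -(setUv E) setIUr integral_setU.
    + by rewrite PE add0e.
    + exact: measurableI.
    + by apply: measurableI => //; exact: measurableC.
    + rewrite -setIUr setUv setIT; exact: measurable_int (iQ n).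
    + by rewrite disj_set2E setIACA setICr setI0.
  - move=> F mF tF PF; rewrite setI_bigcupr integral_bigcup.
    + by rewrite eseries0// => k _ _; exact: PF.
    + exact: trivIset_setIl.
    + by move=> k; exact: measurableI.
    + by rewrite -setI_bigcupr; apply: iE; exact: bigcupT_measurable.
have ae0 : ae_eq mu2 (Q n) (fun p => (h p)%:E) (cst 0%E).
  apply: integral_ae_eq => //.
  move=> E EQ mE; rewrite integral0 -[RHS](P E mE); congr (integral _ _ _).
  by apply/esym/setIidr.
by apply: filterS ae0 => p /= hp /hp [].
Qed.

(** The weak gradient in the domain of the operator is one among those that differ on a null
    set; the decay estimate is stated for any of them. *)
Lemma weak_derivativeR_unique D e f g1 g2 : measurable (D : set T2) -> S `<=` D ->
  sqint mu2 D g1 -> sqint mu2 D g2 -> weak_derivativeR D e f g1 -> weak_derivativeR D e f g2 ->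
  {ae mu2, forall p, S p -> g1 p = g2 p}.
Proof.
move=> mD SD s1 s2 w1 w2.
have s12 : sqint mu2 D (fun p => g1 p + -1 * g2 p).
  apply: sqintD => //; apply: (@sqint_bddM _ _ _ mu2 D mD (fun=> -1) g2 1) => // p _.
  by rewrite normrN normr1.
have : {ae mu2, forall p, S p -> g1 p + -1 * g2 p = 0}.
  apply: (strip_orth_ae0 mD SD s12) => phi tphi.
  have i1 := sqint_integrableM mD s1 (test_fun_sqint mD tphi).
  have i2 := sqint_integrableM mD s2 (test_fun_sqint mD tphi).
  transitivity (\int[mu2]_(p in D) (g1 p * phi p) - \int[mu2]_(p in D) (g2 p * phi p)).
    by rewrite -RintegralB//; apply: eq_Rintegral => p _; ring.
  by apply/eqP; rewrite subr_eq0 -eqr_opp -w1// -w2.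
apply: (@filterS _ _ (ae_filter_ringOfSetsType mu2)) => p hp /hp /eqP.
by rewrite mulN1r subr_eq0 => /eqP.
Qed.
End bump.

(** * Removing the truncation of the weight *)

Section limit.
Variable R : realType.
Local Notation T2 := (measurableTypeR R * measurableTypeR R)%type.
Local Notation mu2 := (@lebesgue_measure R \x @lebesgue_measure R)%E.
Local Notation S := (@strip R).

Lemma weight_antitone (b d d' x : R) : 0 < d -> d <= d' -> weight b d' x <= weight b d x.
Proof.
move=> d0 dd'; have d'0 := lt_le_trans d0 dd'.
by rewrite lef_pV2 ?posrE ?weight_den_gt0// lerD2l.
Qed.

(** Monotone convergence along [d = n.+1%:R^-1]: a bound uniform in [d] passes to the
    exponential weight. *)
Lemma weighted_integral_le (b C : R) (F : R * R -> R) :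
  measurable_fun (S : set T2) F -> (forall p, 0 <= F p) ->
  (forall d, 0 < d -> (\int[mu2]_(p in S) (sqweight b d p * F p)%:E <= C%:E)%E) ->
  (\int[mu2]_(p in S) (expR (b * p.1) ^+ 2 * F p)%:E <= C%:E)%E.
Proof.
move=> mF F0 hC; pose d (n : nat) : R := n.+1%:R^-1.
have d0 n : 0 < d n by rewrite invr_gt0 ltr0n.
have mS : measurable (S : set T2) by exact: measurable_strip.
pose g n p := (sqweight b (d n) p * F p)%:E.
have mg n : measurable_fun (S : set T2) (g n).
  apply/measurable_EFinP; apply: measurable_funM => //; apply: continuous_measurable2 => //.
  by apply: smooth_continuous => k; apply: CkM; exact: Ck_weight.
have g0 n p : S p -> (0 <= g n p)%E by move=> _; rewrite lee_fin mulr_ge0// sqr_ge0.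
have ndg p : S p -> nondecreasing_seq (g ^~ p).
  move=> _ m n mn; rewrite lee_fin ler_wpM2r// /sqweight.
  rewrite lerXn2r ?nnegrE ?(ltW (weight_gt0 _ _ _))//.
  by apply: weight_antitone => //; rewrite /d lef_pV2 ?posrE ?ltr0n// ler_nat.
have lim p : limn (g ^~ p) = (expR (b * p.1) ^+ 2 * F p)%:E.
  apply/cvg_lim => //; apply/cvg_EFin; first exact: nearW.
  apply: cvgM; last exact: cvg_cst.
  by apply: cvgM; apply: weight_cvg; exact: cvg_harmonic.
rewrite (_ : (\int[mu2]_(p in S) (expR (b * p.1) ^+ 2 * F p)%:E =
    \int[mu2]_(p in S) limn (g ^~ p))%E); last by apply: eq_integral => p _; rewrite lim.
have := @cvg_monotone_convergence _ _ _ mu2 S mS g mg g0 ndg.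
by move=> /cvge_to_le; apply; apply: nearW => n; exact: hC.
Qed.

Definition energy_density (u hx hy : R * R -> R[i]) (p : R * R) : R :=
  sqnormc (u p) + (sqnormc (hx p) + sqnormc (hy p)).

Lemma ae_unique_energy (theta : R) (u gx gy gx' gy' : R * R -> R[i]) :
  0 < theta < pi / 2 -> H1 (Omega theta) u gx gy -> H1 (Omega theta) u gx' gy' ->
  {ae mu2, forall p, S p -> energy_density u gx gy p = energy_density u gx' gy' p}.
Proof.
move=> ht [_ Lgx Lgy wx wy] [_ Lgx' Lgy' wx' wy'].
have mO := measurable_Omega theta; have SO := strip_Omega ht.
move: Lgx Lgy => /(L2P _ mO)[xr xi] /(L2P _ mO)[yr yi].
move: Lgx' Lgy' => /(L2P _ mO)[xr' xi'] /(L2P _ mO)[yr' yi'].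
move: wx wy wx' wy' => /weak_derivativeP[wxr wxi] /weak_derivativeP[wyr wyi].
move=> /weak_derivativeP[wxr' wxi'] /weak_derivativeP[wyr' wyi'].
have u1 := weak_derivativeR_unique mO SO xr xr' wxr wxr'.
have u2 := weak_derivativeR_unique mO SO xi xi' wxi wxi'.
have u3 := weak_derivativeR_unique mO SO yr yr' wyr wyr'.
have u4 := weak_derivativeR_unique mO SO yi yi' wyi wyi'.
have AF := ae_filter_ringOfSetsType mu2.
have u12 := @filterI _ _ AF _ _ u1 u2; have u34 := @filterI _ _ AF _ _ u3 u4.
move: (@filterI _ _ AF _ _ u12 u34).
apply: (@filterS _ _ AF) => p [[e1 e2] [e3 e4]] Sp.
by rewrite /energy_density !sqnormcE e1// e2// e3// e4.
Qed.
End limit.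

(** * Decay of the eigenfunctions *)

Local Notation plane_measure R := (@lebesgue_measure R \x @lebesgue_measure R)%E.
Local Notation plane R := (measurableTypeR R * measurableTypeR R)%type.

Theorem proposition6p1 (R : realType) (theta : R)
    (htheta : 0 < theta < pi / 2)
    (lambda : R) (hlambda : lambda < 1)
    (psi : R * R -> R[i]) (hpsi : mix_eigenvector theta lambda psi)
    (gx gy : R * R -> R[i]) (hgrad : H1 (Omega theta) psi gx gy)
    (eps : R) (heps : 0 < eps) :
  (\int[@lebesgue_measure R]_(x in `]0%R, +oo[)
     \int[@lebesgue_measure R]_(y in `]0%R, pi[)
       (expR (2 * x * (Num.sqrt (1 - lambda) - eps)) *
        (sqnormc (psi (x, y)) + (sqnormc (gx (x, y)) + sqnormc (gy (x, y)))))%:E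
   < +oo)%E.
Proof.
have [_ [_ [gx' [gy' [fdom form]]]]] := hpsi.
set r := Num.sqrt (1 - lambda); have r0 : 0 < r by rewrite sqrtr_gt0 subr_gt0.
(* The rate [r - eps] may be negative, while the weights increase only for a positive one. *)
pose b := Num.max (r - eps) (r / 2).
have b0 : 0 < b by rewrite lt_max [X in _ || X]divr_gt0 ?orbT.
have br : b < r by rewrite gt_max; apply/andP; split; lra.
have lb : lambda + b ^+ 2 < 1.
  rewrite -ltrBrDl -[ltRHS]sqr_sqrtr ?subr_ge0 ?(ltW hlambda)// -/r.
  by rewrite ltrXn2r ?nnegrE// ltW.
have [C hC] := agmon_bound htheta b0 lb fdom form.
have mO := measurable_Omega theta; have mS := measurable_strip (R := R).
have SO := strip_Omega htheta.
have [[Lu Lgx' Lgy' _ _] _] := fdom; have [_ Lgx Lgy _ _] := hgrad.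
have meas (v : R * R -> R[i]) : L2 (Omega theta) v ->
    measurable_fun (@strip R : set (plane R)) (fun p => sqnormc (v p)).
  move=> [mr mi _]; apply/measurable_EFinP; apply: measurable_sqnormc.
    by apply: measurable_funS mr.
  by apply: measurable_funS mi.
pose F := energy_density psi.
have F0 hx hy p : 0 <= F hx hy p by rewrite !addr_ge0 ?sqnormc_ge0.
have mF hx hy : L2 (Omega theta) hx -> L2 (Omega theta) hy ->
    measurable_fun (@strip R : set (plane R)) (F hx hy).
  by move=> Lx Ly; apply: measurable_funD; [|apply: measurable_funD]; exact: meas.
have mexp (c : R) : measurable_fun (@strip R : set (plane R)) (fun p => expR (c * p.1)).
  apply: measurable_funTS; apply: (@measurableT_comp _ _ _ _ _ _ (fun x : R => expR (c * x))) => //.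
  apply: continuous_measurable_fun => x; apply: (@continuous_comp _ _ _ (fun x : R => c * x) expR).
    by apply: cvgM; [exact: cvg_cst|exact: cvg_id].
  exact: continuous_expR.
have bound := weighted_integral_le (mF _ _ Lgx' Lgy') (F0 gx' gy') hC.
have aeF := ae_unique_energy htheta hgrad fdom.1.
pose G p := (expR (2 * p.1 * (r - eps)) * F gx gy p)%:E.
have mG : measurable_fun (@strip R : set (plane R)) G.
  apply/measurable_EFinP; apply: measurable_funM; last exact: mF.
  by have := mexp (2 * (r - eps)); congr measurable_fun; apply/funext => p; rewrite mulrAC.
have G0 p : (0 <= G p)%E by rewrite lee_fin mulr_ge0// expR_ge0.
rewrite (_ : integral _ _ _ = \int[(plane_measure R)]_(p in @strip R) G p)%E; last first.
  by rewrite (tonelli_strip mG).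
have mH hx hy : L2 (Omega theta) hx -> L2 (Omega theta) hy ->
    measurable_fun (@strip R : set (plane R)) (fun p => (expR (b * p.1) ^+ 2 * F hx hy p)%:E).
  by move=> Lx Ly; apply/measurable_EFinP; apply: measurable_funM; [exact: measurable_funX|exact: mF].
have H0 hx hy p : (0 <= (expR (b * p.1) ^+ 2 * F hx hy p)%:E)%E.
  by rewrite lee_fin mulr_ge0// sqr_ge0.
apply: (@le_lt_trans _ _ C%:E); last by rewrite ltry.
apply: le_trans bound.
rewrite -(@ge0_ae_eq_integral _ _ _ (plane_measure R) (@strip R)
  (fun p => (expR (b * p.1) ^+ 2 * F gx gy p)%:E)
  (fun p => (expR (b * p.1) ^+ 2 * F gx' gy' p)%:E)) //.
- apply: ge0_le_integral => //; first exact: mH.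
  move=> p [p1 _ _]; rewrite lee_fin ler_wpM2r// -expRM_natl ler_expR.
  have rb : r - eps <= b by rewrite le_max lexx.
  nra.
- exact: mH.
- exact: mH.
- by apply: (@filterS _ _ (ae_filter_ringOfSetsType (plane_measure R))) aeF => p e Sp; rewrite /F e.
Qed.
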